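(* Let $T\in\mathbb N\cup\{\infty\}$ and let $\mathcal Q^e$ be a non-empty subset of $\mathcal D^e_{0,T}$ that is stable under concatenation. Define for all $t\in[0,T]\cap\mathbb N$, $$\phi_{t,T}(X):=\operatorname{ess\,inf}_{a\in\mathcal Q^e}\frac{\langle X,a\rangle_{t,T}}{\langle1,a\rangle_{t,T}},\qquad X\in\mathcal R^\infty_{t,T}.$$ Then $(\phi_{t,T})_{t\in[0,T]\cap\mathbb N}$ is a relevant time-consistent coherent utility functional process.
   Context: Setup. $\mathbb N=\{0,1,2,\dots\}$; $(\Omega,\mathcal F,(\mathcal F_t)_{t\in\mathbb N},P)$ is a filtered probability space with $\mathcal F_0=\{\emptyset,\Omega\}$; stopping times are $(\mathcal F_t)$-stopping times. All equalities and inequalities between random variables or processes (for processes: simultaneously for all $t$) and all equalities and inclusions between events are understood $P$-almost surely. $\mathcal R^0$ is the space of real-valued adapted processes $(X_t)_{t\in\mathbb N}$ (a.s. equal processes are identified); $\mathcal R^\infty$ is the subspace of those with $\sup_{t}|X_t|\le m$ for some $m\in\mathbb R$. For stopping times $0\le\tau<\infty$, $\tau\le\theta\le\infty$, put $\pi_{\tau,\theta}(X)_t:=1_{\{\tau\le t\}}X_{t\wedge\theta}$ and $\mathcal R^\infty_{\tau,\theta}:=\pi_{\tau,\theta}\mathcal R^\infty$. $1_{[\tau,\infty)}$ and $1_{[\tau,\theta)}$ are the processes $t\mapsto1_{\{\tau\le t\}}$ and $t\mapsto1_{\{\tau\le t<\theta\}}$. Dual space. For $a\in\mathcal R^0$ put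 $a_{-1}:=0$, $\Delta a_t:=a_t-a_{t-1}$, $\|a\|_{\mathcal A^1}:=E[\sum_{t\in\mathbb N}|\Delta a_t|]$. $\mathcal A^1:=\{a\in\mathcal R^0:\|a\|_{\mathcal A^1}<\infty\}$, $\mathcal A^1_+:=\{a\in\mathcal A^1:\Delta a_t\ge0\ \forall t\}$. $\langle X,a\rangle_{\tau,\theta}:=E[\sum_{t\in[\tau,\theta]\cap\mathbb N}X_t\Delta a_t\mid\mathcal F_\tau]$. $(\mathcal A^1_{\tau,\theta})_+:=\pi_{\tau,\theta}\mathcal A^1_+$, $\mathcal D_{\tau,\theta}:=\{a\in(\mathcal A^1_{\tau,\theta})_+:\langle1,a\rangle_{\tau,\theta}=1\}$, $\mathcal D^e_{\tau,\theta}:=\{a\in\mathcal D_{\tau,\theta}:P[\sum_{j\ge t\wedge\theta}\Delta a_j>0]=1\ \text{for all }t\in\mathbb N\}$. Functionals. A monetary utility functional on $\mathcal R^\infty_{\tau,\theta}$ is a map $\phi:\mathcal R^\infty_{\tau,\theta}\to L^\infty(\mathcal F_\tau)$ with: (0) $\phi(1_AX)=1_A\phi(X)$ for all $X$ and $A\in\mathcal F_\tau$; (1) $\phi(X)\le\phi(Y)$ whenever $X\le Y$; (2) $\phi(X+m1_{[\tau,\infty)})=\phi(X)+m$ for all $X\in\mathcal R^\infty_{\tau,\theta}$, $m\in L^\infty(\mathcal F_\tau)$. It is concave if (3) $\phi(\lambda X+(1-\lambda)Y)\ge\lambda\phi(X)+(1-\lambda)\phi(Y)$ for all $X,Y$ and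 $\lambda\in L^\infty(\mathcal F_\tau)$, $0\le\lambda\le1$; coherent if in addition (4) $\phi(\lambda X)=\lambda\phi(X)$ for all $X$ and $\lambda\in L^\infty(\mathcal F_\tau)$, $\lambda\ge0$. For $X\in\mathcal R^\infty$, $\phi(X):=\phi(\pi_{\tau,\theta}(X))$. $\phi$ is $\theta$-relevant if $A\subset\{\phi(-\varepsilon1_A1_{[t\wedge\theta,\infty)})<0\}$ for all $\varepsilon>0$, $t\in\mathbb N$, $A\in\mathcal F_{t\wedge\theta}$. Processes. A coherent utility functional process $(\phi_{t,T})_{t\in[0,T]\cap\mathbb N}$ consists of a coherent utility functional $\phi_{t,T}$ on $\mathcal R^\infty_{t,T}$ for each $t$; it is relevant if every $\phi_{t,T}$ is $T$-relevant. For a finite stopping time $\tau\le T$ and $X\in\mathcal R^\infty_{\tau,T}$, $\phi_{\tau,T}(X):=\sum_{t\in[0,T]\cap\mathbb N}\phi_{t,T}(1_{\{\tau=t\}}X)$. The process is time-consistent if $\phi_{t,T}(X)=\phi_{t,T}(X1_{[t,\theta)}+\phi_{\theta,T}(X)1_{[\theta,\infty)})$ for each $t\in[0,T]\cap\mathbb N$, every finite stopping time $\theta$ with $t\le\theta\le T$ and all $X\in\mathcal R^\infty_{t,T}$. Concatenation. For $a,b\in\mathcal A^1_+$, a finite stopping time $\theta$ and $A\in\mathcal F_\theta$, $(a\oplus^\theta_Ab)_t:=a_t$ on $\{t<\theta\}\cup A^c\cup\{\langle1,b\rangle_{\theta,\infty}=0\}$ and $(a\oplus^\theta_Ab)_t:=a_{\theta-1}+\frac{\langle1,a\rangle_{\theta,\infty}}{\langle1,b\rangle_{\theta,\infty}}(b_t-b_{\theta-1})$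 on $\{t\ge\theta\}\cap A\cap\{\langle1,b\rangle_{\theta,\infty}>0\}$, with $a_{-1}=b_{-1}=0$. A subset $\mathcal Q\subset\mathcal A^1_+$ is stable under concatenation if $a\oplus^\theta_Ab\in\mathcal Q$ for all $a,b\in\mathcal Q$, every finite stopping time $\theta$ and all $A\in\mathcal F_\theta$. *)

(* Defs.v *)
From HB Require Import structures.
From mathcomp Require Import all_boot all_order all_algebra.
From mathcomp Require Import all_classical all_reals all_analysis.
Set Implicit Arguments.
Unset Strict Implicit.
Unset Printing Implicit Defensive.
Import Order.TTheory GRing.Theory Num.Theory.
Import numFieldNormedType.Exports.
Local Open Scope classical_set_scope.
Local Open Scope ring_scope.

(* Conventions.  Random variables and processes are represented by functions,
   not by classes modulo almost sure equality.  Every space below is closed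
   under almost sure equality of (measurable) representatives, maps between
   such spaces are required to respect it (field [muf_ae]), and every equality,
   inequality or inclusion is stated P-almost surely. *)

(* The times N \cup {oo}: [None] is oo. *)
Definition natbar := option nat.

Definition tle (s t : natbar) : bool :=
  match s, t with
  | _, None => true
  | None, Some _ => false
  | Some m, Some n => (m <= n)%N
  end.

Definition tmin (t : nat) (u : natbar) : nat :=
  if u is Some n then minn t n else t.

Section filtered_space.
Context {R : realType} {d : measure_display} {Omega : measurableType d}.
Variables (P : probability Omega R) (F : nat -> set (set Omega)).

Notation rvar := (Omega -> R).
Notation process := (nat -> Omega -> R).
Notation rtime := (Omega -> natbar).

Definition filtration :=
  [/\ forall t, sigma_algebra setT (F t),
      forall t, F t `<=` measurable
    & forall s t, (s <= t)%N -> F s `<=` F t].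

Definition stopping_time (tau : rtime) :=
  forall t, F t [set w | tle (tau w) (Some t)].

Definition ae_finite (tau : rtime) := {ae P, forall w, tau w <> None}.

Definition ae_tle (tau theta : rtime) :=
  {ae P, forall w, tle (tau w) (theta w)}.

Definition sigma_stop (tau : rtime) : set (set Omega) :=
  [set A | measurable A /\
    forall t, F t (A `&` [set w | tle (tau w) (Some t)])].

Definition measurable_wrt (G : set (set Omega)) (Z : rvar) :=
  measurable_fun setT (Z : g_sigma_algebraType G -> R).

(* A version of E[Y | G]; the default value [cst 0] is used only when there is
   none, which does not happen for integrable [Y]. *)
Definition is_cond_exp (G : set (set Omega)) (Y Z : rvar) :=
  [/\ measurable_wrt G Z,
      P.-integrable setT (EFin \o Z)
    & forall A, G A ->
        \int[P]_(w in A) (Z w)%:E = \int[P]_(w in A) (Y w)%:E]%E.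

Definition cond_exp (G : set (set Omega)) (Y : rvar) : rvar :=
  xget (cst 0) [set Z | is_cond_exp G Y Z].

(* Essential infimum of a family of random variables, i.e. its greatest lower
   bound for the P-almost sure order (the library's [ess_inf] is that of a
   single function).  The default value [cst 0] is used only when there is no
   real-valued one, which does not happen for non-empty uniformly bounded
   families. *)
Definition is_ess_inf_family (S : set rvar) (Z : rvar) :=
  [/\ measurable_fun setT Z,
      forall Y, S Y -> {ae P, forall w, Z w <= Y w}
    & forall Z' : rvar, measurable_fun setT Z' ->
        (forall Y, S Y -> {ae P, forall w, Z' w <= Y w}) ->
        {ae P, forall w, Z' w <= Z w}].

Definition ess_inf_family (S : set rvar) : rvar :=
  xget (cst 0) [set Z | is_ess_inf_family S Z].

Definition L0 (G : set (set Omega)) : set rvar :=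
  [set Z | measurable_fun setT Z /\
    exists2 Z' : rvar, measurable_wrt G Z' & {ae P, forall w, Z w = Z' w}].

Definition Linfty (G : set (set Omega)) : set rvar :=
  [set Z | L0 G Z /\ exists M : R, {ae P, forall w, `|Z w| <= M}].

Definition process_ae_eq (X Y : process) :=
  {ae P, forall w, forall t, X t w = Y t w}.

Definition process_ae_le (X Y : process) :=
  {ae P, forall w, forall t, X t w <= Y t w}.

Definition R0 : set process := [set X | forall t, L0 (F t) (X t)].

Definition Rinfty : set process :=
  [set X | R0 X /\ exists m : R, {ae P, forall w, forall t, `|X t w| <= m}].

Definition stop_proj (tau theta : rtime) (X : process) : process :=
  fun t w => if tle (tau w) (Some t) then X (tmin t (theta w)) w else 0.

Definition Rinfty_between (tau theta : rtime) : set process :=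
  [set X | R0 X /\
    exists2 Y, Rinfty Y & process_ae_eq X (stop_proj tau theta Y)].

(* The processes 1_{[tau, oo)} and 1_{[tau, theta)}. *)
Definition ind_from (tau : rtime) : process :=
  fun t w => if tle (tau w) (Some t) then 1 else 0.

Definition ind_between (tau theta : rtime) : process :=
  fun t w =>
    if tle (tau w) (Some t) && ~~ tle (theta w) (Some t) then 1 else 0.

(* [before a t] is a_{t-1}, with a_{-1} = 0. *)
Definition before (a : process) (t : nat) (w : Omega) : R :=
  if t is s.+1 then a s w else 0.

Definition increment (a : process) : process :=
  fun t w => a t w - before a t w.

Definition norm_A1 (a : process) : \bar R :=
  (\int[P]_w \sum_(0 <= t <oo) `|increment a t w|%:E)%E.

Definition A1 : set process := [set a | R0 a /\ (norm_A1 a < +oo)%E].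

Definition A1_pos : set process :=
  [set a | A1 a /\ {ae P, forall w, forall t, 0 <= increment a t w}].

Definition pairing (tau theta : rtime) (X a : process) : rvar :=
  cond_exp (sigma_stop tau) (fun w =>
    \big[+%R/0]_(0 <= t <oo | tle (tau w) (Some t) && tle (Some t) (theta w))
      (X t w * increment a t w)).

Definition one_process : process := fun _ _ => 1.

Definition A1_pos_between (tau theta : rtime) : set process :=
  [set a | R0 a /\
    exists2 b, A1_pos b & process_ae_eq a (stop_proj tau theta b)].

Definition Dset (tau theta : rtime) : set process :=
  [set a | A1_pos_between tau theta a /\
    {ae P, forall w, pairing tau theta one_process a w = 1}].

Definition Dset_e (tau theta : rtime) : set process :=
  [set a | Dset tau theta a /\ forall t,
    {ae P, forall w,
      0 < \big[+%R/0]_(tmin t (theta w) <= j <oo) increment a j w}].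

Record monetary_utility_functional (tau theta : rtime)
    (phi : process -> rvar) : Prop := {
  muf_codomain : forall X, Rinfty_between tau theta X ->
    Linfty (sigma_stop tau) (phi X) ;
  muf_ae : forall X Y,
    Rinfty_between tau theta X -> Rinfty_between tau theta Y ->
    process_ae_eq X Y -> {ae P, forall w, phi X w = phi Y w} ;
  muf_local : forall X A, Rinfty_between tau theta X -> sigma_stop tau A ->
    {ae P, forall w,
      phi (fun t w' => \1_A w' * X t w') w = \1_A w * phi X w} ;
  muf_monotone : forall X Y,
    Rinfty_between tau theta X -> Rinfty_between tau theta Y ->
    process_ae_le X Y -> {ae P, forall w, phi X w <= phi Y w} ;
  muf_translation : forall X m,
    Rinfty_between tau theta X -> Linfty (sigma_stop tau) m ->
    {ae P, forall w,
      phi (fun t w' => X t w' + m w' * ind_from tau t w') w = phi X w + m w}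
}.

Record concave_utility_functional (tau theta : rtime)
    (phi : process -> rvar) : Prop := {
  cuf_monetary : monetary_utility_functional tau theta phi ;
  cuf_concave : forall X Y l,
    Rinfty_between tau theta X -> Rinfty_between tau theta Y ->
    Linfty (sigma_stop tau) l -> {ae P, forall w, 0 <= l w <= 1} ->
    {ae P, forall w,
      l w * phi X w + (1 - l w) * phi Y w
      <= phi (fun t w' => l w' * X t w' + (1 - l w') * Y t w') w}
}.

Record coherent_utility_functional (tau theta : rtime)
    (phi : process -> rvar) : Prop := {
  chuf_concave : concave_utility_functional tau theta phi ;
  chuf_homogeneous : forall X l,
    Rinfty_between tau theta X ->
    Linfty (sigma_stop tau) l -> {ae P, forall w, 0 <= l w} ->
    {ae P, forall w, phi (fun t w' => l w' * X t w') w = l w * phi X w}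
}.

(* The process -eps 1_A 1_{[t /\ theta, oo)} lies in R^oo and not necessarily
   in R^oo_{tau,theta}, whence the projection. *)
Definition relevant_functional (tau theta : rtime) (phi : process -> rvar) :=
  forall (eps : R) (t : nat) (A : set Omega), 0 < eps ->
    sigma_stop (fun w => Some (tmin t (theta w))) A ->
    {ae P, forall w, A w ->
      phi (stop_proj tau theta (fun s w' =>
        - eps * \1_A w' * ind_from (fun w'' => Some (tmin t (theta w''))) s w'))
        w < 0}.

Definition coherent_utility_process (T : natbar)
    (phi : nat -> process -> rvar) :=
  forall t, tle (Some t) T ->
    coherent_utility_functional (cst (Some t)) (cst T) (phi t).

Definition relevant_process (T : natbar) (phi : nat -> process -> rvar) :=
  forall t, tle (Some t) T ->
    relevant_functional (cst (Some t)) (cst T) (phi t).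

(* phi_{tau,T}(X) for X in R^oo, i.e. phi_{tau,T} at the projection of X. *)
Definition phi_stop (T : natbar) (phi : nat -> process -> rvar)
    (tau : rtime) (X : process) : rvar :=
  fun w => \big[+%R/0]_(0 <= t <oo | tle (Some t) T)
    phi t (fun s w' =>
      \1_[set w'' | tau w'' = Some t] w' * stop_proj tau (cst T) X s w') w.

Definition time_consistent (T : natbar) (phi : nat -> process -> rvar) :=
  forall (t : nat) (theta : rtime) (X : process), tle (Some t) T ->
    stopping_time theta -> ae_finite theta ->
    ae_tle (cst (Some t)) theta -> ae_tle theta (cst T) ->
    Rinfty_between (cst (Some t)) (cst T) X ->
    {ae P, forall w, phi t X w =
      phi t (fun s w' => X s w' * ind_between (cst (Some t)) theta s w'
                         + phi_stop T phi theta X w' * ind_from theta s w') w}.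

Definition concatenation (a b : process) (theta : rtime) (A : set Omega) :
    process := fun t w =>
  if theta w is Some n then
    let pa := pairing theta (cst None) one_process a w in
    let pb := pairing theta (cst None) one_process b w in
    if [&& (n <= t)%N, w \in A & 0 < pb]
    then before a n w + pa / pb * (b t w - before b n w)
    else a t w
  else a t w.

(* Membership of the concatenation is understood modulo almost sure equality,
   so that Q stands for a set of classes whether or not it is saturated. *)
Definition stable_under_concatenation (Q : set process) :=
  forall a b (theta : rtime) A, Q a -> Q b ->
    stopping_time theta -> ae_finite theta -> sigma_stop theta A ->
    exists2 c, Q c & process_ae_eq c (concatenation a b theta A).

Definition phi_of (Q : set process) (T : natbar) (t : nat) (X : process) :
    rvar :=
  ess_inf_family [set Z | exists2 a, Q a &
    Z = fun w => pairing (cst (Some t)) (cst T) X a w /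
                 pairing (cst (Some t)) (cst T) one_process a w].

End filtered_space.

(* Main.v *)
Require Import Defs.
From HB Require Import structures.
From mathcomp Require Import all_boot all_order all_algebra.
From mathcomp Require Import all_classical all_reals all_analysis.
From mathcomp Require Import measurable_realfun measurable_fun_approximation.
From mathcomp Require Import finmap ring.
Set Implicit Arguments.
Unset Strict Implicit.
Unset Printing Implicit Defensive.
Import Order.TTheory GRing.Theory Num.Theory.
Import numFieldNormedType.Exports.
Local Open Scope classical_set_scope.
Local Open Scope ring_scope.

(** The proof rests on writing every functional as an average.  For [a] in [Qe]
    and a time [t <= T], the ratio [<X, a>_{t,T} / <1, a>_{t,T}] is a version of
    the conditional mean of [X] under the weights [Delta a_r], [t <= r <= T].
    It is the only bounded [F_t]-measurable [Z] with
    [E[1_D (sum_r X_r Delta a_r - Z sum_r Delta a_r)] = 0] for all [D] in [F_t]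
    ([average_excess], [excess_eq_average]); the denominator is almost surely
    positive, because elements of [D^e] keep a positive tail.  Hence each average is
    linear with respect to [F_t]-measurable bounded coefficients, monotone and
    equal to 1 at the constant 1, and [phi_{t,T}], an infimum of such maps, is
    coherent.  For relevance, on the set where an average of
    [-eps 1_A 1_{[u,oo)}] is nonnegative, the defining identity says that the
    mean of a nonnegative variable which is positive on [A] vanishes.

    Time-consistency uses concatenation at deterministic times only.  Let
    [replace_from s C U X] be the process which equals [U] on [C] from time [s]
    on, and [X] elsewhere.  If [c] is the concatenation of [a] and [b] at time
    [s] on [C] in [F_s], then for [t <= s] the [c]-average of [X] at time [t] is
    the [a]-average of the process in which [X] has been replaced on [C] from
    [s] on by its [b]-average at time [s] ([average_concat]).  Two consequences:
    - with [a = b] this is the tower property, so replacing [X] from [s] on by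
      [phi_{s,T}(X)] can only lower an average ([average_replace_le]);
    - with [t = s] the averages over [Qe] are directed downwards, so
      [phi_{s,T}(X)] is the almost sure limit of the averages of a sequence of
      elements of [Qe] ([ex_ess_inf_sequence], [phi_limit]).  This also shows
      that the essential infimum exists and is [F_s]-measurable.
    Since concatenations stay in [Qe], [phi_{t,T}(X)] is below the [a]-average
    of [X] replaced by the [b_n]-averages, hence, in the limit, by
    [phi_{s,T}(X)] ([phi_le_average_replace]).

    For a stopping time [theta], the replacement is carried out successively on
    [{theta = t}], [{theta = t+1}], and so on.  After [N] steps this gives a
    process [cut N] which agrees with the pasted process
    [X 1_{[t,theta)} + phi_{theta,T}(X) 1_{[theta,oo)}] on [{theta < N}];
    both inequalities between [phi_{t,T}] of [X] and of the pasted process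
    follow by letting [N] tend to infinity under the averages
    ([phi_cut_limit]). *)

(** * Weighted series of real numbers *)

Section weighted_series.
Variable R : realType.
Implicit Types (x y u : nat -> R).

(** [sum_i x_i u_i] for weights [u], as a limit of real partial sums; it has an
    unspecified value when the series diverges. *)
Definition wsum x u : R := \big[+%R/0]_(0 <= i <oo) (x i * u i).

(** Nonnegative weights with a finite sum. *)
Definition summable_weight u := (forall i, 0 <= u i) /\ cvgn (series u).

Definition bounded_seq x := exists m : R, forall i, `|x i| <= m.

Lemma is_cvg_wsum x u : summable_weight u -> bounded_seq x ->
  cvgn (series (x \* u)).
Proof.
move=> [u0 cu] [m xm]; apply: normed_cvg.
apply: (@series_le_cvg _ _ (m *: u)) => [n|n|n|].
- exact: normr_ge0.
- by rewrite /GRing.scale/= mulr_ge0// (le_trans _ (xm n)).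
- by rewrite /GRing.scale/= normrM (ger0_norm (u0 n)) ler_wpM2r.
- exact: is_cvg_seriesZ.
Qed.

Lemma wsumE x u : wsum x u = limn (series (x \* u)).
Proof. by []. Qed.

Lemma wsum_lin (k l : R) x y u : summable_weight u ->
  bounded_seq x -> bounded_seq y ->
  wsum (fun i => k * x i + l * y i) u = k * wsum x u + l * wsum y u.
Proof.
move=> su bx by_; have cx := is_cvg_wsum su bx; have cy := is_cvg_wsum su by_.
rewrite !wsumE.
rewrite (_ : series _ = series (k *: (x \* u) + l *: (y \* u))); last first.
  by congr series; apply/funext => i; rewrite /= mulrDl -!mulrA.
rewrite lim_seriesD; [|exact: is_cvg_seriesZ..].
by rewrite !lim_seriesZ.
Qed.

Lemma le_wsum x y u : summable_weight u -> bounded_seq x -> bounded_seq y ->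
  (forall i, x i <= y i) -> wsum x u <= wsum y u.
Proof.
move=> su bx by_ xy; rewrite !wsumE; apply: lim_series_le => [||n].
- exact: is_cvg_wsum.
- exact: is_cvg_wsum.
- by rewrite /= ler_wpM2r// su.1.
Qed.

Lemma bounded_seq_cst (k : R) : bounded_seq (fun=> k).
Proof. by exists `|k|. Qed.

Lemma wsumZ (k : R) x u : summable_weight u -> bounded_seq x ->
  wsum (fun i => k * x i) u = k * wsum x u.
Proof.
move=> su bx; rewrite -[RHS]addr0 -(mul0r (wsum x u)) -wsum_lin//.
by congr wsum; apply/funext => i; ring.
Qed.

Lemma wsum_norm (m : R) x y u : summable_weight u -> bounded_seq y ->
  (forall i, `|x i| <= m * y i) -> `|wsum x u| <= m * wsum y u.
Proof.
move=> su by_ xm.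
have bmy : bounded_seq (fun i => m * y i).
  by case: by_ => M yM; exists (`|m| * M) => i; rewrite normrM ler_wpM2l.
have bx : bounded_seq x.
  by case: bmy => M yM; exists M => i; rewrite (le_trans (xm i))// (le_trans (ler_norm _)).
have bmyN : bounded_seq (fun i => - m * y i).
  by case: bmy => M yM; exists M => i; rewrite mulNr normrN.
rewrite -wsumZ// ler_norml -mulN1r -wsumZ//; apply/andP; split; apply: le_wsum => //.
- by case: bmy => M yM; exists M => i; rewrite mulN1r normrN.
- by move=> i; have := xm i; rewrite mulN1r ler_norml => /andP[].
- by move=> i; have := xm i; rewrite ler_norml => /andP[].
Qed.

Lemma wsum_ge0 x u : summable_weight u -> bounded_seq x ->
  (forall i, 0 <= x i) -> 0 <= wsum x u.
Proof.
move=> su bx x0; have -> : 0 = wsum (fun=> 0) u.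
  by rewrite -[LHS](mul0r (wsum x u)) -wsumZ//; congr wsum; apply/funext => i; rewrite mul0r.
by apply: le_wsum => //; exact: bounded_seq_cst.
Qed.

End weighted_series.

(** * Measurability of limits *)

Section measurable_lim.
Context {d} {T : measurableType d} {R : realType}.

(** No convergence is assumed: where the sequence diverges, [limn] takes a fixed
    default value, and the set of divergence is measurable. *)
Lemma measurable_fun_lim (f : (T -> R)^nat) :
  (forall n, measurable_fun setT (f n)) ->
  measurable_fun setT (fun x => limn (f ^~ x)).
Proof.
move=> mf; pose S x : \bar R := limn_esup (fun n => (f n x)%:E).
pose I x : \bar R := limn_einf (fun n => (f n x)%:E).
have mS : measurable_fun setT S.
  by apply: measurable_fun_limn_esup => n; exact/measurable_EFinP.
have mI : measurable_fun setT I.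
  rewrite (_ : I = fun x => - limn_esup (fun n => (- f n x)%:E))%E; last first.
    apply/funext => x; rewrite /I -(oppeK (limn_einf _)) -limn_esupN.
    by [].
  apply: measurableT_comp => //.
  apply: measurable_fun_limn_esup => n; apply/measurable_EFinP.
  exact: measurable_funN.
have cvgP x : cvgn (f ^~ x) <-> (S x == I x) && (S x \is a fin_num).
  split=> [/cvg_ex[l fl]|].
    have /cvg_limn_einf_sup[Il Sl] : (fun n => (f n x)%:E) @ \oo --> l%:E.
      by apply: cvg_EFin => //; exact: nearW.
    by rewrite /S /I Il Sl eqxx.
  move=> /andP[/eqP SI Sfin].
  have [l Sl] : exists l : R, S x = l%:E by exists (fine (S x)); rewrite fineK.
  apply/cvg_ex; exists l; apply: (@fine_cvg _ _ _ _ (fun n => (f n x)%:E)).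
  have eI : einfs (fun n => (f n x)%:E) @ \oo --> l%:E.
    by rewrite -Sl SI /I limn_einf_lim; exact: is_cvg_einfs.
  have eS : esups (fun n => (f n x)%:E) @ \oo --> l%:E.
    by rewrite -Sl /S limn_esup_lim; exact: is_cvg_esups.
  apply: squeeze_cvge eI eS; apply: nearW => n; apply/andP; split.
    by apply: ereal_inf_lbound; exists n => /=.
  by apply: ereal_sup_ubound; exists n => /=.
pose b x := (S x == I x) && (S x \is a fin_num).
have mb : measurable_fun setT b.
  apply: measurable_and.
    apply: (measurable_fun_bool true); rewrite [X in measurable X](_ : _ =
        setT `&` [set x | S x = I x]); first exact: measurable_eqe.
    by apply/seteqP; split => x [_ /eqP].
  apply: (measurable_fun_bool true); exact: emeasurable_fin_num.
rewrite (_ : (fun x => limn (f ^~ x)) =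
    fun x => if b x then fine (S x) else point); last first.
  apply/funext => x; case: ifPn => bx; last first.
    by rewrite dvgP// => /cvgP; apply/negP.
  have /cvg_ex[l fl] : cvgn (f ^~ x) by exact/cvgP.
  rewrite (cvg_lim _ fl)//.
  have /cvg_limn_einf_sup[_ Sl] : (fun n => (f n x)%:E) @ \oo --> l%:E.
    by apply: cvg_EFin => //; exact: nearW.
  by rewrite /S Sl.
apply: measurable_fun_ifT => //; apply: measurableT_comp => //.
Qed.

End measurable_lim.

(** * Expectation of real random variables *)

(** Throughout, [itg f] says that the real random variable [f] is integrable, and
    [Ex f] is its real-valued expectation. *)

Section expectation.
Context {R : realType} {d : measure_display} {Omega : measurableType d}.
Variable P : probability Omega R.
Implicit Types (f g h : Omega -> R).

Local Notation itg f := (P.-integrable setT (EFin \o f)).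
Local Notation Ex f := (\int[P]_w f w).

Lemma itg_measurable f : itg f -> measurable_fun setT f.
Proof. by move=> /measurable_int /measurable_EFinP. Qed.

Lemma ae_le_anti f g : {ae P, forall w, f w <= g w} ->
  {ae P, forall w, g w <= f w} -> {ae P, forall w, f w = g w}.
Proof. by apply: filterS2 => w fg gf; apply/eqP; rewrite eq_le fg gf. Qed.

Lemma itg_ae_le f g : measurable_fun setT f -> itg g ->
  {ae P, forall w, `|f w| <= g w} -> itg f.
Proof.
move=> mf ig fg; apply/integrableP; split; first exact/measurable_EFinP.
have mg := itg_measurable ig.
have /integrableP[_] := ig; apply: le_lt_trans.
apply: ae_ge0_le_integral => //.
- by apply: measurableT_comp => //; exact/measurable_EFinP.
- by apply: measurableT_comp => //; exact/measurable_EFinP.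
- by apply: filterS fg => w fgw _; rewrite /= lee_fin (le_trans fgw)// ler_norm.
Qed.

Lemma itg_cst (k : R) : itg (fun=> k).
Proof. by apply: finite_measure_integrable_cst. Qed.

Lemma itg_bounded f (m : R) : measurable_fun setT f ->
  {ae P, forall w, `|f w| <= m} -> itg f.
Proof. by move=> mf fm; apply: (itg_ae_le mf (itg_cst m)). Qed.

Lemma itgD f g : itg f -> itg g -> itg (f \+ g).
Proof. by move=> hf hg; exact: (integrableD measurableT hf hg). Qed.

Lemma itgB f g : itg f -> itg g -> itg (f \- g).
Proof. by move=> hf hg; exact: (integrableB measurableT hf hg). Qed.

Lemma itgN f : itg f -> itg (\- f).
Proof. by move=> hf; exact: (integrableN hf). Qed.

Lemma itgZ (k : R) f : itg f -> itg (fun w => k * f w).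
Proof. by move=> hf; exact: (integrableZl measurableT k hf). Qed.

Lemma itg_abs f : itg f -> itg (fun w => `|f w|).
Proof. by move=> hf; exact: integrable_norm. Qed.

Lemma itgM_bounded h f (m : R) : measurable_fun setT h ->
  {ae P, forall w, `|h w| <= m} -> itg f -> itg (h \* f).
Proof.
move=> mh hm hf; apply: (@itg_ae_le _ (fun w => m * `|f w|)).
- by apply: measurable_funM => //; exact: itg_measurable.
- by apply: itgZ; exact: itg_abs.
- by apply: filterS hm => w hw; rewrite /= normrM ler_wpM2r.
Qed.

Lemma itg_indic A f : measurable A -> itg f -> itg (\1_A \* f).
Proof.
move=> mA; apply: (@itgM_bounded _ _ 1); first exact: measurable_indic.
by apply: aeW => w; rewrite indicE; case: (_ \in _); rewrite ?normr1 ?normr0.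
Qed.

Lemma ExB f g : itg f -> itg g -> Ex (f \- g) = Ex f - Ex g.
Proof. by move=> *; exact: RintegralB. Qed.

Lemma ExD f g : itg f -> itg g -> Ex (f \+ g) = Ex f + Ex g.
Proof. by move=> *; exact: RintegralD. Qed.

Lemma ExZ k f : itg f -> Ex (fun w => k * f w) = k * Ex f.
Proof. by move=> *; exact: RintegralZl. Qed.

Lemma Ex_ae_eq f g : measurable_fun setT f -> measurable_fun setT g ->
  {ae P, forall w, f w = g w} -> Ex f = Ex g.
Proof.
move=> mf mg fg; congr fine; apply: ae_eq_integral => //.
- exact/measurable_EFinP.
- exact/measurable_EFinP.
- by apply: filterS fg => w /= -> _.
Qed.

Lemma Ex_ae_le f g : itg f -> itg g ->
  {ae P, forall w, f w <= g w} -> Ex f <= Ex g.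
Proof.
move=> hf hg fg; have mf := itg_measurable hf; have mg := itg_measurable hg.
have -> : Ex f = Ex (fun w => Num.min (f w) (g w)).
  apply: Ex_ae_eq => //; first exact: measurable_minr.
  by apply: filterS fg => w /min_idPl ->.
apply: le_Rintegral => //; last by move=> w _; rewrite ge_min lexx orbT.
apply: (@itg_ae_le _ (fun w => `|f w|)).
- exact: measurable_minr.
- exact: itg_abs.
- by apply: filterS fg => w /min_idPl ->.
Qed.

Lemma Ex_ge0 f : itg f -> {ae P, forall w, 0 <= f w} -> 0 <= Ex f.
Proof.
move=> hf f0; have -> : 0 = Ex (fun=> 0 : R).
  by rewrite Rintegral_cst// mul0r.
exact: Ex_ae_le (itg_cst 0) hf f0.
Qed.

Lemma Ex_le0_ae0 f : itg f -> {ae P, forall w, 0 <= f w} -> Ex f <= 0 ->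
  {ae P, forall w, f w = 0}.
Proof.
move=> hf f0 Ef; have mf := itg_measurable hf.
have E0 : Ex (fun w => `|f w|) = 0.
  apply/eqP; rewrite eq_le; apply/andP; split; last exact: Rintegral_ge0.
  rewrite (le_trans _ Ef)//; apply: Ex_ae_le => //; first exact: itg_abs.
  by apply: filterS f0 => w /ger0_norm ->.
have : (\int[P]_w `|(f w)%:E| = 0)%E.
  rewrite -[LHS]fineK; first by rewrite -[fine _]/(Ex (fun w => `|f w|)) E0.
  exact: integrable_fin_num (itg_abs hf).
move/(ae_eq_integral_abs _ measurableT).
move/(_ (measurable_int _ hf)).
by apply: filterS => w /(_ Logic.I) [].
Qed.

(** Dominated convergence. *)
Lemma Ex_dominated (f_ : nat -> Omega -> R) f g :
  (forall n, measurable_fun setT (f_ n)) -> measurable_fun setT f -> itg g ->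
  {ae P, forall w, f_ ^~ w @ \oo --> f w} ->
  {ae P, forall w, forall n, `|f_ n w| <= g w} ->
  Ex (f_ n) @[n --> \oo] --> Ex f.
Proof.
move=> mf_ mf ig ff fg.
have [||||hf _ hc] := @dominated_convergence _ _ _ P setT measurableT
  (fun n => EFin \o f_ n) (EFin \o f) (EFin \o g) _ _ _ ig _.
- by move=> n; exact/measurable_EFinP.
- exact/measurable_EFinP.
- by apply: filterS ff => w fw _; apply: cvg_EFin => //; exact: nearW.
- by apply: filterS fg => w fw n _; rewrite /= lee_fin.
apply: fine_cvg; rewrite fineK//; exact: integrable_fin_num.
Qed.

End expectation.

(** * Conditional expectation and measurability up to null sets *)

Import HBSimple HBNNSimple.

Lemma measurable_inv (R : realType) : measurable_fun setT (@GRing.inv R).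
Proof.
rewrite -(setvU [set 0]); apply/measurable_funU => //; first exact: measurableC.
split; last exact: measurable_fun_set1.
apply: open_continuous_measurable_fun => [|x]; first exact/closed_openC/closed_eq.
by move=> /set_mem/= /eqP x0; exact: inv_continuous.
Qed.

Section conditional_expectation.
Context {R : realType} {d : measure_display} {Omega : measurableType d}.
Variable P : probability Omega R.
Variable G : set (set Omega).
Hypotheses (sG : sigma_algebra setT G) (GM : G `<=` measurable).
Implicit Types (f g h Y Z : Omega -> R).

Local Notation itg f := (P.-integrable setT (EFin \o f)).
Local Notation Ex f := (\int[P]_w f w).

Lemma sub_measurableE (A : set (g_sigma_algebraType G)) : measurable A = G A.
Proof. by rewrite -[LHS]/(<<s G >> A) sigma_algebra_id. Qed.

Lemma measurable_wrt_measurable Z : measurable_wrt G Z -> measurable_fun setT Z.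
Proof.
move=> mZ _ B mB; apply: GM; have := mZ measurableT B mB.
by rewrite sub_measurableE.
Qed.

Lemma measurable_wrt_indic A : G A -> measurable_wrt G (\1_A : Omega -> R).
Proof. by move=> GA; apply: measurable_indic; rewrite sub_measurableE. Qed.

(* The identity as a map onto [Omega] with the smaller sigma-algebra; the law of
   this map is the restriction of [P] to [G]. *)
Let sub_id : Omega -> g_sigma_algebraType G := id.

Let msub_id : measurable_fun setT sub_id.
Proof. by move=> _ B; rewrite sub_measurableE setTI => /GM. Qed.

Let sub_mfun : {mfun Omega >-> g_sigma_algebraType G} :=
  MeasurableFun.Pack (MeasurableFun.Class (isMeasurableFun.Build _ _ _ _ _ msub_id)).

(** Conditional expectations are Radon-Nikodym derivatives: the signed measure
    [A |-> E[1_A Y]], restricted to [G], is dominated by the restriction of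
    [P]. *)
Lemma ex_is_cond_exp Y : itg Y -> exists Z, is_cond_exp P G Y Z.
Proof.
move=> iY; pose mu : probability _ R := distribution P sub_mfun.
pose nu : {charge set (g_sigma_algebraType G) -> \bar R} :=
  measure_function_pushforward__canonical__charge_Charge (induced_charge iY) msub_id.
have numu : nu `<< mu.
  apply: dominates_pushforward => //.
  apply/null_content_dominatesP => A mA PA; apply: null_set_integral => //.
  exact: measurable_int (integrableS measurableT mA (@subsetT _ _) iY).
have Zfin := fun x => Radon_Nikodym_fin_num x numu.
pose Z := fine \o Radon_Nikodym nu mu.
have ZE : Radon_Nikodym nu mu = EFin \o Z.
  by apply/funext => x; rewrite /Z /= fineK.
have iZ : mu.-integrable setT (EFin \o Z).
  by rewrite -ZE; exact: Radon_Nikodym_integrable.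
have mZ : measurable_fun setT (EFin \o Z) by exact: measurable_int iZ.
have iZP : itg Z.
  apply/integrableP; split.
    by apply/measurable_EFinP; apply: measurable_wrt_measurable; exact/measurable_EFinP.
  have /integrableP[_] := iZ.
  rewrite (ge0_integral_distribution sub_mfun)//.
  exact: measurableT_comp.
exists Z; split => //; first exact/measurable_EFinP.
move=> A GA; have mA : measurable (A : set (g_sigma_algebraType G)).
  by rewrite sub_measurableE.
have iZA : P.-integrable (sub_id @^-1` A) ((EFin \o Z) \o sub_id).
  by apply: integrableS iZP => //; exact: GM.
have := Radon_Nikodym_integral numu mA; rewrite ZE.
by rewrite [X in _ = X -> _](integral_pushforward msub_id mZ iZA mA) => <-.
Qed.

Lemma cond_expP Y : itg Y -> is_cond_exp P G Y (cond_exp P G Y).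
Proof.
move=> /ex_is_cond_exp[Z HZ]; rewrite /cond_exp.
exact: (@xgetPex _ _ [set Z | is_cond_exp P G Y Z] (ex_intro _ Z HZ)).
Qed.

Lemma Ex_indic A f : measurable A -> Ex (fun w => \1_A w * f w) = fine (\int[P]_(w in A) (f w)%:E)%E.
Proof.
move=> mA; rewrite -[RHS]/(\int[P]_(w in A) f w) [RHS]Rintegral_mkcond.
apply: eq_Rintegral => w _; rewrite patchE indicE.
by case: ifPn => wA; rewrite ?mul1r ?mul0r.
Qed.

Lemma is_cond_exp_Ex Y Z A : is_cond_exp P G Y Z -> G A ->
  Ex (fun w => \1_A w * Z w) = Ex (fun w => \1_A w * Y w).
Proof. by move=> [_ _ E] GA; rewrite !Ex_indic ?E//; exact: GM. Qed.

Lemma Ex_sum (I : Type) (s : seq I) (F : I -> Omega -> R) :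
  (forall i, itg (F i)) ->
  itg (fun w => \sum_(i <- s) F i w) /\
  Ex (fun w => \sum_(i <- s) F i w) = \sum_(i <- s) Ex (F i).
Proof.
move=> iF; elim: s => [|i s [IH1 IH2]].
  rewrite (_ : (fun w => _) = (fun=> 0)); last first.
    by apply/funext => w; rewrite big_nil.
  by rewrite big_nil Rintegral_cst// mul0r; split => //; exact: itg_cst.
rewrite (_ : (fun w => _) = F i \+ (fun w => \sum_(i <- s) F i w)); last first.
  by apply/funext => w; rewrite big_cons.
by rewrite big_cons ExD// IH2; split => //; exact: itgD.
Qed.

(** A variable [Y] whose mean vanishes on every set of [G] is orthogonal to all
    [G]-measurable [h] for which [h Y] is integrable; [h] may be unbounded. *)
Lemma Ex_pull_out_ge0 h Y : measurable_wrt G h -> (forall w, 0 <= h w) ->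
  itg Y -> itg (h \* Y) ->
  (forall A, G A -> Ex (fun w => \1_A w * Y w) = 0) ->
  Ex (h \* Y) = 0.
Proof.
move=> mh h0 iY ihY Y0.
have meh : measurable_fun setT (EFin \o h : g_sigma_algebraType G -> \bar R).
  exact/measurable_EFinP.
pose h_ := nnsfun_approx measurableT meh.
have mh_ n : measurable_fun setT (h_ n : Omega -> R).
  by apply: measurable_wrt_measurable; exact: measurable_funPT.
have h_le n w : h_ n w <= h w.
  by rewrite -lee_fin /h_ nnsfun_approxE; apply: le_approx => // x _; rewrite lee_fin.
have Eh_ n : Ex (h_ n \* Y) = 0.
  rewrite (_ : h_ n \* Y = fun w => \sum_(y <- fset_set (range (h_ n)))
      y * (\1_(h_ n @^-1` [set y]) w * Y w)); last first.
    apply/funext => w; rewrite /= [X in X * _](fimfunE (h_ n)) fsbig_finite//=.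
    by rewrite big_distrl/=; apply: eq_bigr => y _; rewrite mulrA.
  have GA y : G (h_ n @^-1` [set y]).
    by rewrite -sub_measurableE -[X in measurable X]setTI; exact: measurable_funPT.
  rewrite (Ex_sum _ _).2 => [|y]; last first.
    by apply: itgZ; apply: itg_indic => //; exact: GM.
  rewrite big1// => y _; rewrite ExZ ?Y0 ?mulr0//.
  by apply: itg_indic => //; exact: GM.
have : Ex (h_ n \* Y) @[n --> \oo] --> Ex (h \* Y).
  apply: (Ex_dominated _ _ (itg_abs ihY)) => [n|||].
  - by apply: measurable_funM => //; exact: (itg_measurable iY).
  - exact: (itg_measurable ihY).
  - apply: aeW => w; apply: cvgMr_tmp.
    apply: (@fine_cvg _ _ _ _ (EFin \o h_^~ w)).
    apply: cvg_nnsfun_approx => // x _; rewrite lee_fin//.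
  - apply: aeW => w n; rewrite /= !normrM ler_wpM2r// !ger0_norm//.
under eq_fun do rewrite Eh_.
by move=> /cvg_lim <-//; rewrite lim_cst.
Qed.

Lemma Ex_pull_out h Y : measurable_wrt G h -> itg Y -> itg (h \* Y) ->
  (forall A, G A -> Ex (fun w => \1_A w * Y w) = 0) ->
  Ex (h \* Y) = 0.
Proof.
move=> mh iY ihY Y0.
have mY := itg_measurable iY.
have mhM := measurable_wrt_measurable mh.
have ihp : itg (h^\+ \* Y).
  apply: (itg_ae_le _ (itg_abs ihY)).
    by apply: measurable_funM => //; exact: measurable_funrpos.
  apply: aeW => w; rewrite !normrM ler_wpM2r// (ger0_norm (funrpos_ge0 h w)).
  by rewrite /funrpos ge_max ler_norm normr_ge0.
have ihn : itg (h^\- \* Y).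
  apply: (itg_ae_le _ (itg_abs ihY)).
    by apply: measurable_funM => //; exact: measurable_funrneg.
  apply: aeW => w; rewrite !normrM ler_wpM2r// (ger0_norm (funrneg_ge0 h w)).
  by rewrite /funrneg ge_max -normrN ler_norm normr_ge0.
rewrite (_ : h \* Y = (h^\+ \* Y) \- (h^\- \* Y)); last first.
  by apply/funext => w /=; rewrite -mulrBl -{1}(funrposBneg h).
rewrite ExB// (Ex_pull_out_ge0 _ (funrpos_ge0 h) iY ihp Y0).
  by rewrite (Ex_pull_out_ge0 _ (funrneg_ge0 h) iY ihn Y0) ?subr0//; exact: measurable_funrneg.
exact: measurable_funrpos.
Qed.

Lemma measurable_wrt_L0 Z : measurable_wrt G Z -> L0 P G Z.
Proof.
move=> mZ; split; first exact: measurable_wrt_measurable.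
by exists Z => //; exact: aeW.
Qed.

(** The same for [h] which agree almost surely with a [G]-measurable variable. *)
Lemma L0_pull_out h Y : L0 P G h -> itg Y -> itg (h \* Y) ->
  (forall A, G A -> Ex (fun w => \1_A w * Y w) = 0) ->
  Ex (h \* Y) = 0.
Proof.
move=> [mh [h' mh' hh']] iY ihY Y0; have mY := itg_measurable iY.
have mh'M := measurable_wrt_measurable mh'.
have ih'Y : itg (h' \* Y).
  apply: (itg_ae_le _ (itg_abs ihY)); first exact: measurable_funM.
  by apply: filterS hh' => w /= ->.
rewrite -(Ex_pull_out mh' iY ih'Y Y0); apply: Ex_ae_eq.
- exact: measurable_funM.
- exact: measurable_funM.
- by apply: filterS hh' => w /= ->.
Qed.

Lemma L0_cst (k : R) : L0 P G (fun=> k).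
Proof. by apply: measurable_wrt_L0; exact: measurable_cst. Qed.

Lemma L0_indic A : G A -> L0 P G (\1_A).
Proof. by move=> GA; apply: measurable_wrt_L0; exact: measurable_wrt_indic. Qed.

Lemma L0D f g : L0 P G f -> L0 P G g -> L0 P G (f \+ g).
Proof.
move=> [mf [f' mf' ff']] [mg [g' mg' gg']]; split; first exact: measurable_funD.
exists (f' \+ g'); first exact: (@measurable_funD _ (g_sigma_algebraType G)).
by apply: filterS2 ff' gg' => w /= -> ->.
Qed.

Lemma L0M f g : L0 P G f -> L0 P G g -> L0 P G (f \* g).
Proof.
move=> [mf [f' mf' ff']] [mg [g' mg' gg']]; split; first exact: measurable_funM.
exists (f' \* g'); first exact: (@measurable_funM _ (g_sigma_algebraType G)).
by apply: filterS2 ff' gg' => w /= -> ->.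
Qed.

Lemma L0N f : L0 P G f -> L0 P G (\- f).
Proof.
move=> [mf [f' mf' ff']]; split; first exact: measurable_funN.
exists (\- f'); first exact: (@measurable_funN _ (g_sigma_algebraType G)).
by apply: filterS ff' => w /= ->.
Qed.

Lemma L0_lim (f_ : nat -> Omega -> R) f : (forall n, L0 P G (f_ n)) ->
  measurable_fun setT f -> {ae P, forall w, f_ ^~ w @ \oo --> f w} -> L0 P G f.
Proof.
move=> mf_ mf ff; split => //.
have /choice[f' f'P] : forall n, exists f', measurable_wrt G f' /\
    {ae P, forall w, f_ n w = f' w}.
  by move=> n; have [_ [f' ? ?]] := mf_ n; exists f'.
exists (fun w => limn (f'^~ w)).
  apply: (@measurable_fun_lim _ (g_sigma_algebraType G)) => n.
  exact: (f'P n).1.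
have /ae_foralln ff' : forall n, {ae P, forall w, f_ n w = f' n w}.
  by move=> n; exact: (f'P n).2.
apply: filterS2 ff ff' => w fw ff'w; apply/esym/cvg_lim => //.
by rewrite (_ : f'^~ w = f_^~ w)//; apply/funext => n; rewrite ff'w.
Qed.

(** Sets of [G] represent comparisons of elements of [L0] up to a null set. *)
Lemma L0_lt f g : L0 P G f -> L0 P G g ->
  exists2 D, G D & {ae P, forall w, D w <-> f w < g w}.
Proof.
move=> [mf [f' mf' ff']] [mg [g' mg' gg']].
exists [set w | f' w < g' w].
  rewrite -sub_measurableE.
  have := @measurable_fun_ltr _ (g_sigma_algebraType G) _ setT _ _ mf' mg'.
  move=> /(_ measurableT [set true]); rewrite setTI; exact.
by apply: filterS2 ff' gg' => w /= -> ->.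
Qed.

Lemma measurable_wrt_div f g : measurable_wrt G f -> measurable_wrt G g ->
  measurable_wrt G (fun w => f w / g w).
Proof.
move=> mf mg; apply: (@measurable_funM _ (g_sigma_algebraType G)) => //.
by apply: measurableT_comp => //; exact: measurable_inv.
Qed.

Lemma Linfty_itg Z f : Linfty P G Z -> itg f -> itg (Z \* f).
Proof. by move=> [[mZ _] [M ZM]]; exact: itgM_bounded ZM. Qed.

Lemma Linfty_cst (k : R) : Linfty P G (fun=> k).
Proof. by split; [exact: L0_cst|exists `|k|; exact: aeW]. Qed.

Lemma Linfty_indic D : G D -> Linfty P G (\1_D).
Proof.
move=> GD; split; first exact: L0_indic.
by exists 1; apply: aeW => w; rewrite indicE; case: (w \in _); rewrite ?normr1 ?normr0.
Qed.

Lemma LinftyM Z Z' : Linfty P G Z -> Linfty P G Z' -> Linfty P G (Z \* Z').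
Proof.
move=> [LZ [M ZM]] [LZ' [M' ZM']]; split; first exact: L0M.
by exists (M * M'); apply: filterS2 ZM ZM' => w ? ?; rewrite /= normrM ler_pM.
Qed.

Lemma LinftyD Z Z' : Linfty P G Z -> Linfty P G Z' -> Linfty P G (Z \+ Z').
Proof.
move=> [LZ [M ZM]] [LZ' [M' ZM']]; split; first exact: L0D.
exists (M + M'); apply: filterS2 ZM ZM' => w ? ?.
by rewrite /= (le_trans (ler_normD _ _))// lerD.
Qed.

Lemma Linfty_lin k l Z Z' : Linfty P G k -> Linfty P G l ->
  Linfty P G Z -> Linfty P G Z' ->
  Linfty P G (fun w => k w * Z w + l w * Z' w).
Proof.
move=> Lk Ll LZ LZ'.
by apply: (LinftyD (LinftyM Lk LZ)); exact: LinftyM.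
Qed.

End conditional_expectation.

Lemma L0_mono {R : realType} {d} {Omega : measurableType d}
  (P : probability Omega R) (G G' : set (set Omega)) Z :
  sigma_algebra setT G -> sigma_algebra setT G' -> G `<=` G' ->
  L0 P G Z -> L0 P G' Z.
Proof.
move=> sG sG' GG' [mZ [Z' mZ' ZZ']]; split => //; exists Z' => // _ B mB.
rewrite (sub_measurableE sG'); apply: GG'; rewrite -(sub_measurableE sG).
exact: mZ'.
Qed.

(** * Integrals of processes against random weights *)

Section weighted_integral.
Context {R : realType} {d : measure_display} {Omega : measurableType d}.
Variable P : probability Omega R.
Implicit Types (f g h Z : Omega -> R) (X Y u : nat -> Omega -> R).

Local Notation itg f := (P.-integrable setT (EFin \o f)).
Local Notation Ex f := (\int[P]_w f w).

(** Pathwise integral [sum_r X_r u_r] of a process against weights; in the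
    application the weights are the increments of an element of the dual. *)
Definition integ X u : Omega -> R := fun w => wsum (X ^~ w) (u ^~ w).

(** Measurable weights, almost surely nonnegative and summable, with integrable
    total mass. *)
Definition random_weight u := [/\ forall r, measurable_fun setT (u r),
  {ae P, forall w, summable_weight (u ^~ w)} &
  itg (integ (fun _ _ => 1) u)].

(** Bounded processes.  Adaptedness plays no role for averages, whose
    measurability comes from conditioning. *)
Definition bounded_process X := (forall r, measurable_fun setT (X r)) /\
  exists m : R, {ae P, forall w, forall r, `|X r w| <= m}.

(** The process killed at the times outside [p]. *)
Definition window (p : pred nat) X : nat -> Omega -> R :=
  fun r w => if p r then X r w else 0.

Lemma measurable_integ X u : (forall r, measurable_fun setT (X r)) ->
  (forall r, measurable_fun setT (u r)) -> measurable_fun setT (integ X u).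
Proof.
move=> mX mu; apply: (@measurable_fun_lim _ _ _
  (fun n w => \sum_(0 <= i < n) X i w * u i w)) => n.
by apply: measurable_sum => i; exact: measurable_funM.
Qed.

Lemma bounded_process_ae X : bounded_process X ->
  {ae P, forall w, bounded_seq (X ^~ w)}.
Proof. by move=> [_ [m Xm]]; apply: filterS Xm => w Xm; exists m. Qed.

Lemma bounded_process_cst (k : R) : bounded_process (fun _ _ => k).
Proof.
by split => [r|]; [exact: measurable_cst|exists `|k|; exact: aeW].
Qed.

Lemma bounded_window p X : bounded_process X -> bounded_process (window p X).
Proof.
move=> [mX [m Xm]]; split => [r|].
  by rewrite /window; case: (p r) => //; exact: measurable_cst.
exists m; apply: filterS Xm => w Xm r; rewrite /window; case: ifP => // _.
by rewrite normr0 (le_trans _ (Xm r)).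
Qed.

Lemma bounded_process_lin (k l : Omega -> R) X Y :
  measurable_fun setT k -> measurable_fun setT l ->
  (exists m : R, {ae P, forall w, `|k w| <= m}) ->
  (exists m : R, {ae P, forall w, `|l w| <= m}) ->
  bounded_process X -> bounded_process Y ->
  bounded_process (fun r w => k w * X r w + l w * Y r w).
Proof.
move=> mk ml [K kK] [L lL] [mX [m Xm]] [mY [n Yn]]; split => [r|].
  by apply: measurable_funD; exact: measurable_funM.
exists (K * m + L * n).
apply: filterS2 (filterI kK lL) (filterI Xm Yn) => w [kw lw] [Xw Yw] r.
rewrite (le_trans (ler_normD _ _))// !normrM lerD// ler_pM//.
Qed.

Lemma integ_lin u X Y (k l : Omega -> R) : random_weight u ->
  bounded_process X -> bounded_process Y ->
  {ae P, forall w, integ (fun r w => k w * X r w + l w * Y r w) u w =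
     k w * integ X u w + l w * integ Y u w}.
Proof.
move=> [_ su _] /bounded_process_ae bX /bounded_process_ae bY.
by apply: filterS3 su bX bY => w su bX bY; exact: wsum_lin.
Qed.

Lemma le_integ u X Y : random_weight u ->
  bounded_process X -> bounded_process Y ->
  {ae P, forall w, forall r, X r w <= Y r w} ->
  {ae P, forall w, integ X u w <= integ Y u w}.
Proof.
move=> [_ su _] /bounded_process_ae bX /bounded_process_ae bY XY.
apply: filterS3 (filterI su XY) bX bY => w [su' XY'] bX' bY'; exact: le_wsum.
Qed.

Lemma integ_norm u X Y (f : Omega -> R) : random_weight u ->
  bounded_process Y ->
  {ae P, forall w, forall r, `|X r w| <= f w * Y r w} ->
  {ae P, forall w, `|integ X u w| <= f w * integ Y u w}.
Proof.
move=> [_ su _] /bounded_process_ae bY XY.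
by apply: filterS3 su XY bY => w su' XY' bY'; exact: wsum_norm.
Qed.

Lemma itg_integ u X : random_weight u -> bounded_process X -> itg (integ X u).
Proof.
move=> wu [mX [m Xm]]; have [mu su i1] := wu.
apply: (itg_ae_le (measurable_integ mX mu) (itgZ m i1)).
apply: (@integ_norm u X (fun _ _ => 1) (fun=> m)) => //.
  exact: bounded_process_cst.
by apply: filterS Xm => w Xm r; rewrite mulr1.
Qed.

End weighted_integral.

(** * Conditional averages *)

Section weighted_average.
Context {R : realType} {d : measure_display} {Omega : measurableType d}.
Variable P : probability Omega R.
Variable G : set (set Omega).
Hypotheses (sG : sigma_algebra setT G) (GM : G `<=` measurable).
Implicit Types (f g h Z : Omega -> R) (X Y u : nat -> Omega -> R).

Local Notation itg f := (P.-integrable setT (EFin \o f)).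
Local Notation Ex f := (\int[P]_w f w).

(** Elements of [L0 P G] are compared by testing their difference, weighted by a
    positive variable [N], against the sets of [G]. *)
Lemma L0_le_weighted Z Z' N : L0 P G Z -> L0 P G Z' ->
  {ae P, forall w, 0 < N w} -> itg (fun w => (Z' w - Z w) * N w) ->
  (forall D, G D -> 0 <= Ex (fun w => \1_D w * ((Z' w - Z w) * N w))) ->
  {ae P, forall w, Z w <= Z' w}.
Proof.
move=> LZ LZ' N0 iN H.
have [D GD DE] := L0_lt sG LZ' LZ.
have mD : measurable D by exact: GM.
have iD := itg_indic mD iN.
have D0 : {ae P, forall w, 0 <= (- (\1_D w * ((Z' w - Z w) * N w)))}.
  apply: filterS2 DE N0 => w DE' N0'; rewrite indicE; have [/set_mem|] := boolP (w \in D).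
    move=> /DE' ZZ; rewrite mul1r oppr_ge0 mulr_le0_ge0 ?(ltW N0')//.
    by rewrite subr_le0 ltW.
  by rewrite mul0r oppr0.
have E0 : Ex (fun w => - (\1_D w * ((Z' w - Z w) * N w))) <= 0.
  rewrite (_ : (fun w => _) = fun w => -1 * (\1_D w * ((Z' w - Z w) * N w))).
    by rewrite ExZ// mulN1r oppr_le0 H.
  by apply/funext => w; rewrite mulN1r.
have := Ex_le0_ae0 (itgN iD) D0 E0.
apply: filterS3 DE N0 => w DE' N0' /=; rewrite indicE => /eqP.
rewrite leNgt oppr_eq0 => E; apply/negP => ZZ.
have := DE'.2 ZZ => /mem_set wD; move: E; rewrite wD mul1r mulf_eq0 (gt_eqF N0') orbF.
by rewrite subr_eq0 => /eqP E; rewrite E ltxx in ZZ.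
Qed.

Lemma is_cond_exp_le f Z f' Z' : is_cond_exp P G f Z -> is_cond_exp P G f' Z' ->
  itg f -> itg f' ->
  {ae P, forall w, f w <= f' w} -> {ae P, forall w, Z w <= Z' w}.
Proof.
move=> cY cY' iY iY' YY'; have [mZ iZ _] := cY; have [mZ' iZ' _] := cY'.
have iB := itgB iZ' iZ.
have E1 (g : Omega -> R) : (fun w => g w * 1) = g by apply/funext => w; rewrite mulr1.
apply: (@L0_le_weighted _ _ (fun=> 1)).
- exact: measurable_wrt_L0.
- exact: measurable_wrt_L0.
- by apply: aeW => w.
- by rewrite E1.
move=> D GD; have mD : measurable D by exact: GM.
rewrite (_ : (fun w => _) = (\1_D \* Z') \- (\1_D \* Z)); last first.
  by apply/funext => w /=; rewrite mulr1 mulrBr.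
rewrite ExB; [|exact: itg_indic..].
rewrite (is_cond_exp_Ex GM cY GD) (is_cond_exp_Ex GM cY' GD).
rewrite subr_ge0; apply: Ex_ae_le; [exact: itg_indic..|].
by apply: filterS YY' => w YY' /=; rewrite ler_wpM2l.
Qed.

Section average.
Variables (p : pred nat) (u : nat -> Omega -> R).
Hypothesis wu : random_weight P u.

Let N := integ (window p (fun _ _ => 1)) u.
Hypothesis N_gt0 : {ae P, forall w, 0 < N w}.

(** The conditional average of [X] over the times in [p] with weights [u]:
    the ratio of the conditional expectations given [G] of
    [sum_{r in p} X_r u_r] and of the mass [N = sum_{r in p} u_r]. *)
Definition average X : Omega -> R := fun w =>
  cond_exp P G (integ (window p X) u) w / cond_exp P G N w.

Local Notation bproc := (bounded_process P).

Lemma itg_window X : bproc X -> itg (integ (window p X) u).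
Proof. by move=> bX; apply: itg_integ => //; exact: bounded_window. Qed.

Lemma itg_mass : itg N.
Proof. by apply: itg_window; exact: bounded_process_cst. Qed.

Lemma cond_mass_gt0 : {ae P, forall w, 0 < cond_exp P G N w}.
Proof.
have [mC iC _] := cond_expP sG GM itg_mass.
have LC := measurable_wrt_L0 P sG GM mC.
have [D GD DE] := L0_lt sG (L0_cst P sG GM 0) LC.
have GD' : G (~` D) by rewrite -setTD; case: sG => _ + _; apply.
have mD' : measurable (~` D) by exact: GM.
have E0 : Ex (\1_(~` D) \* N) <= 0.
  rewrite -(is_cond_exp_Ex GM (cond_expP sG GM itg_mass) GD').
  have E00 : Ex (fun=> 0 : R) = 0 by rewrite Rintegral_cst// mul0r.
  rewrite -[leRHS]E00.
  apply: Ex_ae_le; [exact: itg_indic|exact: itg_cst|].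
  apply: filterS DE => w DE; rewrite indicE.
  have [/set_mem/= nD|] := boolP (w \in ~` D); last by rewrite mul0r.
  by rewrite mul1r leNgt; apply/negP => /DE.
have /(_ _ E0) := Ex_le0_ae0 (itg_indic mD' itg_mass).
have N0 : {ae P, forall w, 0 <= (\1_(~` D) \* N) w}.
  by apply: filterS N_gt0 => w N0; rewrite /= mulr_ge0 ?(ltW N0).
move=> /(_ N0); apply: filterS3 DE N_gt0 => w DE N0' /eqP.
rewrite /= mulf_eq0 (gt_eqF N0') orbF indicE; case: (boolP (w \in _)) => [|nD _].
  by rewrite oner_eq0.
by apply/DE; apply: contrapT => /mem_set; apply/negP.
Qed.

Lemma window_norm X (f : Omega -> R) :
  {ae P, forall w, forall r, p r -> `|X r w| <= f w} ->
  {ae P, forall w, `|integ (window p X) u w| <= f w * N w}.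
Proof.
move=> Xf; apply: integ_norm => //.
  exact/bounded_window/bounded_process_cst.
apply: filterS Xf => w Xf r; rewrite /window; case: ifP => pr.
  by rewrite mulr1 Xf.
by rewrite normr0 mulr0.
Qed.

Lemma average_wrt X : bproc X -> measurable_wrt G (average X).
Proof.
move=> bX; have [mX _ _] := cond_expP sG GM (itg_window bX).
by have [mC _ _] := cond_expP sG GM itg_mass; exact: measurable_wrt_div.
Qed.

Lemma average_L0 X : bproc X -> L0 P G (average X).
Proof. by move=> bX; apply: measurable_wrt_L0 => //; exact: average_wrt. Qed.

Lemma average_norm X (m : R) : bproc X ->
  {ae P, forall w, forall r, p r -> `|X r w| <= m} ->
  {ae P, forall w, `|average X w| <= m}.
Proof.
move=> bX Xm; have iX := itg_window bX; have cX := cond_expP sG GM iX.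
have iN := itg_mass; have cN := cond_expP sG GM iN.
have cZ (k : R) : is_cond_exp P G (fun w => k * N w)
    (fun w => k * cond_exp P G N w).
  have [mC iC EC] := cN; split.
  - apply: (@measurable_funM _ (g_sigma_algebraType G)) => //.
  - exact: itgZ.
  - move=> A GA; have mA : measurable A by exact: GM.
    have iCA := integrableS measurableT mA (@subsetT _ _) iC.
    have iNA := integrableS measurableT mA (@subsetT _ _) iN.
    under eq_integral do rewrite EFinM.
    under [RHS]eq_integral do rewrite EFinM.
    by rewrite !integralZl// EC.
have up := is_cond_exp_le cX (cZ m) iX (itgZ m iN).
have lo := is_cond_exp_le (cZ (- m)) cX (itgZ (- m) iN) iX.
have XN := window_norm Xm.
have {}up : {ae P, forall w, cond_exp P G (integ (window p X) u) w <= m * cond_exp P G N w}.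
  by apply: up; apply: filterS XN => w; rewrite ler_norml => /andP[].
have {}lo : {ae P, forall w, - m * cond_exp P G N w <= cond_exp P G (integ (window p X) u) w}.
  by apply: lo; apply: filterS XN => w; rewrite mulNr ler_norml => /andP[].
apply: filterS3 up lo cond_mass_gt0 => w up lo N0.
by rewrite ler_norml /average ler_pdivlMr// ler_pdivrMr// lo up.
Qed.

Lemma average_Linfty X : bproc X -> Linfty P G (average X).
Proof.
move=> bX; split; first exact: average_L0.
have [_ [m Xm]] := bX; exists m; apply: average_norm => //.
by apply: filterS Xm.
Qed.

(** The weighted sum of [X] minus that of the constant-in-time process [Z]. *)
Definition excess X Z : Omega -> R := fun w => integ (window p X) u w - Z w * N w.

Lemma itg_excess X Z : bproc X -> Linfty P G Z -> itg (excess X Z).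
Proof.
move=> bX LZ; apply: itgB; first exact: itg_window.
exact: (Linfty_itg LZ itg_mass).
Qed.

(** The defining property of the average.  [Z |-> E[1_D excess X Z]] is
    decreasing in [Z], so that the three lemmas that follow it turn the sign of
    these expectations into a comparison with [Z]. *)
Lemma average_excess X h : bproc X -> Linfty P G h ->
  Ex (h \* excess X (average X)) = 0.
Proof.
move=> bX Lh; have LA := average_Linfty bX; have iE := itg_excess bX LA.
apply: (L0_pull_out sG GM Lh.1 iE); first exact: (Linfty_itg Lh iE).
move=> D GD; have mD : measurable D by exact: GM.
have iX := itg_window bX; have cX := cond_expP sG GM iX.
have iN := itg_mass; have cN := cond_expP sG GM iN.
have [_ iCX _] := cX; have [_ iCN _] := cN.
have iD : itg ((\1_D \* average X) \* (N \- cond_exp P G N)).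
  exact: (Linfty_itg (LinftyM (Linfty_indic P sG GM GD) LA) (itgB iN iCN)).
have iB := itgB (itg_indic mD iX) (itg_indic mD iCX).
rewrite (@Ex_ae_eq _ _ _ _ _ (((\1_D \* integ (window p X) u) \-
     (\1_D \* cond_exp P G (integ (window p X) u))) \-
   ((\1_D \* average X) \* (N \- cond_exp P G N)))); last first.
- apply: filterS cond_mass_gt0 => w N0.
  rewrite /= /excess /average; field; exact: lt0r_neq0.
- exact: (itg_measurable (itgB iB iD)).
- exact: (itg_measurable (itg_indic mD iE)).
rewrite ExB// ExB; [|exact: itg_indic..].
rewrite (is_cond_exp_Ex GM cX GD) subrr sub0r.
rewrite (L0_pull_out sG GM _ (itgB iN iCN) iD) ?oppr0//.
  by apply: L0M; [exact: L0_indic|exact: average_L0].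
move=> C GC; have mC : measurable C by exact: GM.
rewrite (_ : (fun w => _) = (\1_C \* N) \- (\1_C \* cond_exp P G N)).
  rewrite ExB; [|exact: itg_indic..].
  by rewrite (is_cond_exp_Ex GM cN GC) subrr.
by apply/funext => w; rewrite /= mulrBr.
Qed.

Lemma excess_ge_average X Z : bproc X -> Linfty P G Z ->
  (forall D, G D -> 0 <= Ex (\1_D \* excess X Z)) ->
  {ae P, forall w, Z w <= average X w}.
Proof.
move=> bX LZ H; have LA := average_Linfty bX.
have E : (fun w => (average X w - Z w) * N w) = excess X Z \- excess X (average X).
  by apply/funext => w; rewrite /= /excess; ring.
have iZ := itg_excess bX LZ; have iA := itg_excess bX LA.
apply: (@L0_le_weighted _ _ N) => //.
- exact: LZ.1.
- exact: LA.1.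
- by rewrite E; exact: itgB.
move=> D GD; have mD : measurable D by exact: GM.
rewrite (_ : (fun w => _) = (\1_D \* excess X Z) \- (\1_D \* excess X (average X))).
  rewrite ExB; [|exact: itg_indic..].
  by rewrite average_excess ?subr0 ?H//; exact: Linfty_indic.
by apply/funext => w; rewrite /= /excess; ring.
Qed.

Lemma excess_le_average X Z : bproc X -> Linfty P G Z ->
  (forall D, G D -> Ex (\1_D \* excess X Z) <= 0) ->
  {ae P, forall w, average X w <= Z w}.
Proof.
move=> bX LZ H; have LA := average_Linfty bX.
have E : (fun w => (Z w - average X w) * N w) = excess X (average X) \- excess X Z.
  by apply/funext => w; rewrite /= /excess; ring.
have iZ := itg_excess bX LZ; have iA := itg_excess bX LA.
apply: (@L0_le_weighted _ _ N) => //.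
- exact: LA.1.
- exact: LZ.1.
- by rewrite E; exact: itgB.
move=> D GD; have mD : measurable D by exact: GM.
rewrite (_ : (fun w => _) = (\1_D \* excess X (average X)) \- (\1_D \* excess X Z)).
  rewrite ExB; [|exact: itg_indic..].
  by rewrite average_excess ?sub0r ?oppr_ge0 ?H//; exact: Linfty_indic.
by apply/funext => w; rewrite /= /excess; ring.
Qed.

Lemma excess_eq_average X Z : bproc X -> Linfty P G Z ->
  (forall D, G D -> Ex (\1_D \* excess X Z) = 0) ->
  {ae P, forall w, average X w = Z w}.
Proof.
move=> bX LZ H.
have lo : {ae P, forall w, Z w <= average X w}.
  by apply: excess_ge_average => // D /H ->.
have up : {ae P, forall w, average X w <= Z w}.
  by apply: excess_le_average => // D /H ->.
exact: ae_le_anti up lo.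
Qed.

End average.

End weighted_average.

(** * Linearity, monotonicity and continuity of averages *)

Section average_theory.
Context {R : realType} {d : measure_display} {Omega : measurableType d}.
Variable P : probability Omega R.
Variable G : set (set Omega).
Hypotheses (sG : sigma_algebra setT G) (GM : G `<=` measurable).
Implicit Types (f g h Z : Omega -> R) (X Y : nat -> Omega -> R).
Variables (p : pred nat) (u : nat -> Omega -> R).
Hypothesis wu : random_weight P u.

Let N := integ (window p (fun _ _ => 1)) u.
Hypothesis N_gt0 : {ae P, forall w, 0 < N w}.

Local Notation itg f := (P.-integrable setT (EFin \o f)).
Local Notation Ex f := (\int[P]_w f w).
Local Notation bproc := (bounded_process P).
Local Notation average := (average P G p u).
Local Notation excess := (excess p u).

Let LA X (bX : bproc X) : Linfty P G (average X) :=
  average_Linfty sG GM wu N_gt0 bX.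

(** Linearity holds for bounded [G]-measurable coefficients. *)
Lemma average_lin k l X Y : Linfty P G k -> Linfty P G l ->
  bproc X -> bproc Y ->
  {ae P, forall w, average (fun r w => k w * X r w + l w * Y r w) w =
    k w * average X w + l w * average Y w}.
Proof.
move=> Lk Ll bX bY.
have bL : bproc (fun r w => k w * X r w + l w * Y r w).
  by apply: bounded_process_lin => //; [exact: Lk.1.1|exact: Ll.1.1|exact: Lk.2|exact: Ll.2].
have LL := Linfty_lin Lk Ll (LA bX) (LA bY).
apply: (excess_eq_average sG GM wu N_gt0 bL) => // D GD.
have mD : measurable D by exact: GM.
have LDk := LinftyM (Linfty_indic P sG GM GD) Lk.
have LDl := LinftyM (Linfty_indic P sG GM GD) Ll.
have iX := itg_excess p wu bX (LA bX); have iY := itg_excess p wu bY (LA bY).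
have ikX := Linfty_itg LDk iX; have ilY := Linfty_itg LDl iY.
rewrite (@Ex_ae_eq _ _ _ _ _ (((\1_D \* k) \* excess X (average X)) \+
   ((\1_D \* l) \* excess Y (average Y)))); last first.
- have H := integ_lin k l wu (bounded_window p bX) (bounded_window p bY).
  have E : integ (window p (fun r w => k w * X r w + l w * Y r w)) u =
      integ (fun r w => k w * window p X r w + l w * window p Y r w) u.
    congr integ; apply/funext => r; apply/funext => w; rewrite /window.
    by case: (p r) => //; rewrite !mulr0 addr0.
  apply: filterS H => w H; rewrite /= /excess E H; ring.
- exact: (itg_measurable (itgD ikX ilY)).
- exact: (itg_measurable (itg_indic mD (itg_excess p wu bL LL))).
rewrite (ExD ikX ilY) -[RHS]addr0; congr (_ + _).
- exact: (average_excess sG GM wu N_gt0 bX LDk).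
- exact: (average_excess sG GM wu N_gt0 bY LDl).
Qed.

Lemma Ex_indic_excess X Z D : bproc X -> Linfty P G Z -> G D ->
  Ex (\1_D \* excess X Z) = Ex (\1_D \* ((average X \- Z) \* N)).
Proof.
move=> bX LZ GD; have mD : measurable D by exact: GM.
have iZ := itg_excess p wu bX LZ; have iA := itg_excess p wu bX (LA bX).
rewrite (_ : _ \* (_ \* N) = (\1_D \* excess X Z) \- (\1_D \* excess X (average X))).
  rewrite ExB; [|exact: itg_indic..].
  by rewrite average_excess ?subr0//; exact: Linfty_indic.
by apply/funext => w; rewrite /= /excess -/N; ring.
Qed.

Let iN : itg N := itg_mass p wu.

Lemma itg_diff_mass X Z : bproc X -> Linfty P G Z -> itg ((average X \- Z) \* N).
Proof.
move=> bX LZ; have iZ := itg_excess p wu bX LZ; have iA := itg_excess p wu bX (LA bX).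
rewrite (_ : _ \* N = excess X Z \- excess X (average X)); first exact: itgB.
by apply/funext => w; rewrite /= /excess -/N; ring.
Qed.

Lemma le_average_excess X Z D : bproc X -> Linfty P G Z -> G D ->
  {ae P, forall w, Z w <= average X w} -> 0 <= Ex (\1_D \* excess X Z).
Proof.
move=> bX LZ GD ZA; rewrite Ex_indic_excess//; have mD : measurable D by exact: GM.
apply: Ex_ge0; first exact/itg_indic/itg_diff_mass.
apply: filterS2 ZA N_gt0 => w ZA N0; rewrite /= !mulr_ge0 ?subr_ge0 ?(ltW N0)//.
Qed.

Lemma average_le_excess X Z D : bproc X -> Linfty P G Z -> G D ->
  {ae P, forall w, average X w <= Z w} -> Ex (\1_D \* excess X Z) <= 0.
Proof.
move=> bX LZ GD ZA; rewrite Ex_indic_excess//; have mD : measurable D by exact: GM.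
have E00 : Ex (fun=> 0 : R) = 0 by rewrite Rintegral_cst// mul0r.
rewrite -[leRHS]E00; apply: Ex_ae_le.
- exact/itg_indic/itg_diff_mass.
- exact: itg_cst.
- apply: filterS2 ZA N_gt0 => w ZA N0; rewrite /= mulr_ge0_le0// mulr_le0_ge0 ?(ltW N0)//.
  by rewrite subr_le0.
Qed.

Lemma le_average X Y : bproc X -> bproc Y ->
  {ae P, forall w, forall r, p r -> X r w <= Y r w} ->
  {ae P, forall w, average X w <= average Y w}.
Proof.
move=> bX bY XY; apply: excess_ge_average => //; first exact: LA.
move=> D GD; have mD : measurable D by exact: GM.
have iY := itg_excess p wu bY (LA bX); have iX := itg_excess p wu bX (LA bX).
have <- : Ex (\1_D \* excess X (average X)) = 0.
  by apply: average_excess => //; exact: Linfty_indic.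
apply: Ex_ae_le; [exact: itg_indic..|].
have : {ae P, forall w, integ (window p X) u w <= integ (window p Y) u w}.
  apply: (le_integ wu); [exact: bounded_window..|].
  apply: filterS XY => w XY r; rewrite /window; case: ifP => // pr.
  exact: XY.
by apply: filterS => w H; rewrite /= /excess ler_wpM2l// lerD2r.
Qed.

Lemma eq_average X Y : bproc X -> bproc Y ->
  {ae P, forall w, forall r, p r -> X r w = Y r w} ->
  {ae P, forall w, average X w = average Y w}.
Proof.
move=> bX bY XY.
have le1 : {ae P, forall w, average X w <= average Y w}.
  by apply: le_average => //; apply: filterS XY => w XY r pr; rewrite XY.
have le2 : {ae P, forall w, average Y w <= average X w}.
  by apply: le_average => //; apply: filterS XY => w XY r pr; rewrite XY.
exact: ae_le_anti le1 le2.
Qed.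

Lemma average1 : {ae P, forall w, average (fun _ _ => 1) w = 1}.
Proof.
apply: (excess_eq_average sG GM wu N_gt0 (Z := fun=> 1)).
- exact: bounded_process_cst.
- exact: Linfty_cst.
move=> D GD; rewrite (_ : _ \* _ = fun=> 0) ?Rintegral_cst ?mul0r//.
by apply/funext => w; rewrite /= /excess mul1r subrr mulr0.
Qed.

(** If the distance of [X_ n] to [X] is bounded, uniformly in time, by variables
    [dl n] which are bounded and tend to 0 almost surely, then the expected
    excess converges on each set of [G], and bounds on the averages of [X_ n]
    pass to the limit. *)
Lemma cvg_excess (X_ : nat -> nat -> Omega -> R) X Z (dl : nat -> Omega -> R)
    (M : R) D :
  (forall n, bproc (X_ n)) -> bproc X -> Linfty P G Z -> G D ->
  (forall n, {ae P, forall w, forall r, p r -> `|X_ n r w - X r w| <= dl n w}) ->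
  (forall n, {ae P, forall w, dl n w <= M}) ->
  {ae P, forall w, dl ^~ w @ \oo --> (0 : R)} ->
  Ex (\1_D \* excess (X_ n) Z) @[n --> \oo] --> Ex (\1_D \* excess X Z).
Proof.
move=> bX_ bX LZ GD Xd dM d0; have mD : measurable D by exact: GM.
have iX := itg_excess p wu bX LZ.
have iX_ n := itg_excess p wu (bX_ n) LZ.
have key n : {ae P, forall w, `|excess (X_ n) Z w - excess X Z w| <= dl n w * N w}.
  have bB : bproc (fun r w => 1 * X_ n r w + (- 1) * X r w).
    apply: bounded_process_lin => //.
      by exists 1; apply: aeW => w; rewrite normr1.
    by exists 1; apply: aeW => w; rewrite normrN normr1.
  have H := integ_lin (fun=> 1) (fun=> - 1) wu (bounded_window p (bX_ n)) (bounded_window p bX).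
  have : {ae P, forall w, `|integ (window p (fun r w => 1 * X_ n r w + (- 1) * X r w)) u w|
      <= dl n w * N w}.
    apply: window_norm => //; apply: filterS (Xd n) => w Xd' r pr.
    by rewrite mul1r mulN1r Xd'.
  have E : integ (window p (fun r w => 1 * X_ n r w + (- 1) * X r w)) u =
      integ (fun r w => 1 * window p (X_ n) r w + (- 1) * window p X r w) u.
    congr integ; apply/funext => r; apply/funext => w; rewrite /window.
    by case: (p r) => //; rewrite !mulr0 addr0.
  rewrite E; apply: filterS2 H => w -> /=; rewrite /excess.
  by congr (`|_| <= _); ring.
apply: (Ex_dominated _ _ (itgD (itg_abs iX) (itgZ M iN))).
- by move=> n; exact: (itg_measurable (itg_indic mD (iX_ n))).
- exact: (itg_measurable (itg_indic mD iX)).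
- have /ae_foralln kall := key.
  apply: filterS2 d0 kall => w d0 kw; apply: cvgMl_tmp.
  have d0N : dl n w * N w @[n --> \oo] --> (0 : R).
    by rewrite -(mul0r (N w)); exact: cvgMr_tmp.
  apply/cvgrPdist_le => e e0; move/cvgrPdist_le : d0N => /(_ e e0).
  apply: filterS => n; rewrite sub0r normrN distrC => H.
  by rewrite (le_trans (kw n))// (le_trans (ler_norm _)).
- have /ae_foralln kall := key; have /ae_foralln Mall := dM.
  apply: filterS3 N_gt0 kall Mall => w N0 kw Mw n; rewrite /= normrM.
  rewrite (@le_trans _ _ `|excess (X_ n) Z w|)//.
    rewrite ler_piMl// indicE; case: (w \in D); rewrite ?normr1 ?normr0//.
  rewrite -[excess (X_ n) Z w](subrK (excess X Z w)) addrC.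
  rewrite (le_trans (ler_normD _ _))// lerD// (le_trans (kw n))//.
  by rewrite ler_wpM2r// ltW.
Qed.

Lemma cvg_le_average (X_ : nat -> nat -> Omega -> R) X Z (dl : nat -> Omega -> R)
    (M : R) :
  (forall n, bproc (X_ n)) -> bproc X -> Linfty P G Z ->
  (forall n, {ae P, forall w, forall r, p r -> `|X_ n r w - X r w| <= dl n w}) ->
  (forall n, {ae P, forall w, dl n w <= M}) ->
  {ae P, forall w, dl ^~ w @ \oo --> (0 : R)} ->
  (forall n, {ae P, forall w, Z w <= average (X_ n) w}) ->
  {ae P, forall w, Z w <= average X w}.
Proof.
move=> bX_ bX LZ Xd dM d0 ZX; apply: excess_ge_average => // D GD.
have := cvg_excess bX_ bX LZ GD Xd dM d0 => /cvg_lim <- //.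
apply: limr_ge; first by apply/cvg_ex; eexists; exact: (cvg_excess bX_ bX LZ GD Xd dM d0).
by apply: nearW => n; exact: le_average_excess.
Qed.

Lemma cvg_average_le (X_ : nat -> nat -> Omega -> R) X Z (dl : nat -> Omega -> R)
    (M : R) :
  (forall n, bproc (X_ n)) -> bproc X -> Linfty P G Z ->
  (forall n, {ae P, forall w, forall r, p r -> `|X_ n r w - X r w| <= dl n w}) ->
  (forall n, {ae P, forall w, dl n w <= M}) ->
  {ae P, forall w, dl ^~ w @ \oo --> (0 : R)} ->
  (forall n, {ae P, forall w, average (X_ n) w <= Z w}) ->
  {ae P, forall w, average X w <= Z w}.
Proof.
move=> bX_ bX LZ Xd dM d0 ZX; apply: excess_le_average => // D GD.
have := cvg_excess bX_ bX LZ GD Xd dM d0 => /cvg_lim <- //.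
apply: limr_le; first by apply/cvg_ex; eexists; exact: (cvg_excess bX_ bX LZ GD Xd dM d0).
by apply: nearW => n; exact: average_le_excess.
Qed.

End average_theory.

(** * Averages and concatenation *)

Section concatenated_average.
Context {R : realType} {d : measure_display} {Omega : measurableType d}.
Variable P : probability Omega R.
Implicit Types (f g h Z U : Omega -> R) (C : set Omega) (X Y u v : nat -> Omega -> R).

Local Notation itg f := (P.-integrable setT (EFin \o f)).
Local Notation Ex f := (\int[P]_w f w).
Local Notation bproc := (bounded_process P).

Lemma wsum_add2 (x y x2 u v z : nat -> R) (k : R) :
  summable_weight u -> summable_weight v -> bounded_seq x -> bounded_seq x2 ->
  (forall i, y i * z i = x i * u i + k * (x2 i * v i)) ->
  wsum y z = wsum x u + k * wsum x2 v.
Proof.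
move=> su sv bx bx2 E; have cu := is_cvg_wsum su bx; have cv := is_cvg_wsum sv bx2.
rewrite !wsumE (_ : series (y \* z) = series ((x \* u) + k *: (x2 \* v))); last first.
  by congr series; apply/funext => i; rewrite /= E.
by rewrite lim_seriesD//; [rewrite lim_seriesZ|exact: is_cvg_seriesZ].
Qed.

(** The process equal to [U] on [C] from time [s] on, and to [X] elsewhere. *)
Definition replace_from (s : nat) (C : set Omega) (U : Omega -> R) X :
    nat -> Omega -> R :=
  fun r w => if (s <= r)%N && (w \in C) then U w else X r w.

Lemma bounded_replace_from s C U X : measurable C -> measurable_fun setT U ->
  (exists M : R, {ae P, forall w, `|U w| <= M}) -> bproc X ->
  bproc (replace_from s C U X).
Proof.
move=> mC mU [M UM] [mX [m Xm]]; split => [r|].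
  rewrite /replace_from; case: (s <= r)%N => //=.
  apply: measurable_fun_ifT => //; apply: (measurable_fun_bool true).
  by rewrite setTI (_ : _ @^-1` _ = C)//; apply/seteqP; split => w /=; [exact: set_mem|exact: mem_set].
exists (Num.max M m); apply: filterS2 UM Xm => w Uw Xw r.
by rewrite /replace_from le_max; case: ifP => _; rewrite ?Uw ?Xw ?orbT.
Qed.

Variables (G G' : set (set Omega)).
Hypotheses (sG : sigma_algebra setT G) (GM : G `<=` measurable).
Hypotheses (sG' : sigma_algebra setT G') (GM' : G' `<=` measurable).
Hypothesis GG' : G `<=` G'.
Variables (p : pred nat) (s : nat).
Let p' : pred nat := fun r => p r && (s <= r)%N.
Local Notation mass q u := (integ (window q (fun _ _ => 1)) u).

Lemma window_replace C U X u : random_weight P u -> measurable C ->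
  bproc X ->
  {ae P, forall w, integ (window p (replace_from s C U X)) u w =
    integ (window p (replace_from s C (fun=> 0) X)) u w +
    \1_C w * U w * mass p' u w}.
Proof.
move=> wu mC bX; have [_ su _] := wu.
have b0 : bproc (window p (replace_from s C (fun=> 0) X)).
  apply/bounded_window/bounded_replace_from => //.
  by exists 0; apply: aeW => w; rewrite normr0.
have b1 : bproc (window p' (fun _ _ => 1)).
  exact/bounded_window/bounded_process_cst.
apply: filterS3 su (bounded_process_ae b0) (bounded_process_ae b1) => w su b0' b1'.
apply: wsum_add2 => // i; rewrite /window /replace_from /p' indicE.
by case: (p i); case: (s <= i)%N; case: (w \in C) => /=; ring.
Qed.

Lemma integ_concat C X u v z h : random_weight P u -> random_weight P v ->
  measurable C -> bproc X ->
  {ae P, forall w, forall r, z r w =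
     if (s <= r)%N && (w \in C) then h w * v r w else u r w} ->
  {ae P, forall w, integ (window p X) z w =
    integ (window p (replace_from s C (fun=> 0) X)) u w +
    \1_C w * h w * integ (window p' X) v w}.
Proof.
move=> wu wv mC bX zE; have [_ su _] := wu; have [_ sv _] := wv.
have b0 : bproc (window p (replace_from s C (fun=> 0) X)).
  apply/bounded_window/bounded_replace_from => //.
  by exists 0; apply: aeW => w; rewrite normr0.
have b1 : bproc (window p' X) by exact/bounded_window.
apply: filterS3 (filterI zE sv) su (filterI (bounded_process_ae b0) (bounded_process_ae b1)).
move=> w [zE' sv'] su' [b0' b1'].
apply: wsum_add2 => // i; rewrite zE' /window /replace_from /p' indicE.
by case: (p i); case: (s <= i)%N; case: (w \in C) => /=; ring.
Qed.

(** The weights [z] agree with [u] before [s] and off [C], and on [C] from [s] on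
    with [v] rescaled by [h] so that the conditional mass after [s] is that of
    [u].  Averaging with [z] then amounts to averaging with [v] at time [s] and
    with [u] before. *)
Lemma average_concat C u v z h X :
  random_weight P u -> random_weight P v -> random_weight P z ->
  {ae P, forall w, 0 < mass p u w} -> {ae P, forall w, 0 < mass p z w} ->
  {ae P, forall w, 0 < mass p' v w} ->
  G' C -> measurable_wrt G' h ->
  {ae P, forall w, forall r, z r w =
     if (s <= r)%N && (w \in C) then h w * v r w else u r w} ->
  {ae P, forall w, h w * cond_exp P G' (mass p' v) w = cond_exp P G' (mass p' u) w} ->
  bproc X ->
  {ae P, forall w, average P G p z X w =
    average P G p u (replace_from s C (average P G' p' v X) X) w}.
Proof.
move=> wu wv wz Nu Nz Nv GC mh zE hE bX.
have mC : measurable C by exact: GM'.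
have LU := average_Linfty sG' GM' wv Nv bX.
have LZ := average_Linfty sG GM wz Nz bX.
have L1 := bounded_process_cst P (1 : R).
set U := average P G' p' v X in LU *; set Z := average P G p z X in LZ *.
have LZ' : Linfty P G' Z by split; [exact: L0_mono LZ.1|exact: LZ.2].
have bR : bproc (replace_from s C U X).
  by apply: bounded_replace_from => //; [exact: LU.1.1|exact: LU.2].
pose K Y := integ (window p (replace_from s C (fun=> 0) Y)) u.
have bK Y : bproc Y -> itg (K Y).
  move=> bY; apply: itg_integ => //; apply: bounded_window.
  by apply: bounded_replace_from => //; exists 0; apply: aeW => w; rewrite normr0.
pose k : Omega -> R := fun w => \1_C w * h w.
have Lk : L0 P G' k.
  by apply: L0M => //; [exact: L0_indic|exact: measurable_wrt_L0].
have zX := integ_concat wu wv mC bX zE.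
have z1 := integ_concat wu wv mC L1 zE.
have uX := window_replace U wu mC bX.
have u1 : {ae P, forall w, mass p u w = K (fun _ _ => 1) w + \1_C w * mass p' u w}.
  apply: filterS (window_replace (fun=> 1) wu mC L1) => w.
  rewrite mulr1 => <-; congr (wsum _ _); apply/funext => r.
  by rewrite /window /replace_from; case: ifP => // _; case: ifP.
have mk := Lk.1.
have ikX Y : bproc Y -> itg (k \* integ (window p' Y) v).
  move=> bY; have H := integ_concat wu wv mC bY zE.
  apply: (itg_ae_le _ (itgD (itg_abs (itg_window p wz bY)) (itg_abs (bK _ bY)))).
    by apply: measurable_funM => //; exact: (itg_measurable (itg_window p' wv bY)).
  apply: filterS H => w H.
  have -> : (k \* integ (window p' Y) v) w = integ (window p Y) z w - K Y w.
    by rewrite H /= /K /k addrC addKr.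
  exact: ler_normB.
have ikN : itg (k \* mass p' v) by exact: ikX.
have iNv := itg_mass p' wv; have cNv := cond_expP sG' GM' iNv; have [mCv iCv _] := cNv.
have iNu := itg_mass p' wu; have cNu := cond_expP sG' GM' iNu; have [mCu iCu _] := cNu.
have ikC : itg (k \* cond_exp P G' (mass p' v)).
  apply: (itg_ae_le _ (itg_abs iCu)).
    by apply: measurable_funM => //; exact: (itg_measurable iCv).
  apply: filterS hE => w hE'; rewrite /= /k -mulrA hE' normrM ler_piMl//.
  by rewrite indicE; case: (w \in C); rewrite ?normr1 ?normr0.
have ikE : itg (k \* excess p' v X U).
  rewrite (_ : _ \* _ = (k \* integ (window p' X) v) \- (U \* (k \* mass p' v))).
    by apply: itgB; [exact: ikX|exact: Linfty_itg LU ikN].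
  by apply/funext => w; rewrite /= /excess; ring.
have LUZ : Linfty P G' (U \- Z).
  rewrite (_ : U \- Z = fun w => 1 * U w + (- 1) * Z w); last first.
    by apply/funext => w /=; ring.
  by apply: Linfty_lin => //; exact: Linfty_cst.
suff : {ae P, forall w, average P G p u (replace_from s C U X) w = Z w}.
  by apply: filterS => w ->.
apply: (excess_eq_average sG GM wu Nu bR LZ) => D GD.
have mD : measurable D by exact: GM.
have GD' : G' D by exact: GG'.
have LD := Linfty_indic P sG' GM' GD'.
have LC := Linfty_indic P sG' GM' GC.
(* The excess for [z] minus the excess for [u] of the replaced process is
   [A1 + A2 - A3].  The three means vanish: [A1] by the definition of [U], [A2]
   and [A3] because they pair a [G']-measurable factor with a variable minus
   its conditional expectation given [G']. *)
pose A1 := (\1_D \* k) \* excess p' v X U.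
pose A2 := (\1_D \* (k \* (U \- Z))) \* (mass p' v \- cond_exp P G' (mass p' v)).
pose A3 := (\1_D \* (\1_C \* (U \- Z))) \* (mass p' u \- cond_exp P G' (mass p' u)).
have iA1 : itg A1.
  rewrite (_ : A1 = \1_D \* (k \* excess p' v X U)); first exact: itg_indic.
  by apply/funext => w; rewrite /A1 /=; ring.
have iA2 : itg A2.
  rewrite (_ : A2 = (\1_D \* (U \- Z)) \* ((k \* mass p' v) \- (k \* cond_exp P G' (mass p' v)))).
    by apply: (Linfty_itg (LinftyM LD LUZ)); exact: itgB.
  by apply/funext => w; rewrite /A2 /=; ring.
have iA3 : itg A3.
  by apply: (Linfty_itg (LinftyM LD (LinftyM LC LUZ))); exact: itgB.
have ce0 (f Zf : Omega -> R) : itg f -> is_cond_exp P G' f Zf ->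
    forall B, G' B -> Ex (fun w => \1_B w * (f \- Zf) w) = 0.
  move=> if_ cf B GB; have mB : measurable B by exact: GM'.
  have [_ iZf _] := cf.
  rewrite (_ : (fun w => _) = (\1_B \* f) \- (\1_B \* Zf)); last first.
    by apply/funext => w /=; rewrite mulrBr.
  by rewrite ExB; [rewrite (is_cond_exp_Ex GM' cf GB) subrr|exact: itg_indic..].
have E1 : Ex A1 = 0.
  have L : L0 P G' (\1_D \* k) by apply: L0M => //; exact: LD.1.
  apply: (L0_pull_out sG' GM' L (itg_excess p' wv bX LU) iA1) => B GB.
  by apply: (average_excess sG' GM' wv Nv bX); exact: Linfty_indic.
have E2 : Ex A2 = 0.
  have L : L0 P G' (\1_D \* (k \* (U \- Z))).
    by apply: L0M; [exact: LD.1|apply: L0M => //; exact: LUZ.1].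
  exact: (L0_pull_out sG' GM' L (itgB iNv iCv) iA2 (ce0 _ _ iNv cNv)).
have E3 : Ex A3 = 0.
  have L := (LinftyM LD (LinftyM LC LUZ)).1.
  exact: (L0_pull_out sG' GM' L (itgB iNu iCu) iA3 (ce0 _ _ iNu cNu)).
have iz := itg_indic mD (itg_excess p wz bX LZ).
have iu := itg_indic mD (itg_excess p wu bR LZ).
rewrite (@Ex_ae_eq _ _ _ _ _ (((\1_D \* excess p z X Z) \- A1) \- (A2 \- A3))).
- rewrite (ExB (itgB iz iA1) (itgB iA2 iA3)) (ExB iz iA1) (ExB iA2 iA3) E1 E2 E3 !subr0.
  by apply: (average_excess sG GM wz Nz bX); exact: Linfty_indic.
- exact: (itg_measurable iu).
- exact: (itg_measurable (itgB (itgB iz iA1) (itgB iA2 iA3))).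
apply: filterS3 (filterI zX z1) (filterI uX u1) hE => w [zX' z1'] [uX' u1'] hE'.
rewrite /A1 /A2 /A3 /= /excess zX' z1' uX' u1' /k -/K.
rewrite -hE'; rewrite /K; ring.
Qed.

(** The case of a single weight. *)
Lemma average_tower C u X : random_weight P u ->
  {ae P, forall w, 0 < mass p u w} -> {ae P, forall w, 0 < mass p' u w} ->
  G' C -> bproc X ->
  {ae P, forall w, average P G p u X w =
    average P G p u (replace_from s C (average P G' p' u X) X) w}.
Proof.
move=> wu Nu Nu' GC bX; apply: (@average_concat C u u u (fun=> 1)) => //.
- exact: measurable_cst.
- by apply: aeW => w r; rewrite mul1r; case: ifP.
- by apply: aeW => w; rewrite mul1r.
Qed.

End concatenated_average.

(** * Increments of the elements of the dual space *)

Section admissible.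
Context {R : realType} {d : measure_display} {Omega : measurableType d}.
Variable P : probability Omega R.
Variable F : nat -> set (set Omega).
Hypothesis hF : filtration F.
Variable T : natbar.
Implicit Types (X a b : nat -> Omega -> R).

Local Notation mass q u := (integ (window q (fun _ _ => 1)) u).

(** The times of [[t, T]]. *)
Definition horizon (t : nat) : pred nat := fun r => (t <= r)%N && tle (Some r) T.

Let sF t : sigma_algebra setT (F t). Proof. by case: hF. Qed.
Let FM t : F t `<=` measurable. Proof. by case: hF. Qed.
Let FF s t : (s <= t)%N -> F s `<=` F t. Proof. by case: hF => _ _; apply. Qed.

Lemma sigma_stop_cst t : sigma_stop F (cst (Some t)) = F t.
Proof.
apply/seteqP; split => A.
  by move=> [mA /(_ t)]; rewrite /= leqnn (_ : [set _ | _] = setT) ?setIT//; exact/seteqP.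
move=> FA; split => [|s]; first exact: FM FA.
have [ts|st] := leqP t s.
  rewrite (_ : [set _ | _] = setT) ?setIT; first exact: FF FA.
  by apply/seteqP; split => w //= _.
rewrite (_ : [set _ | _] = set0) ?setI0; first by case: (sF s).
by apply/seteqP; split => w //=; rewrite leqNgt st.
Qed.

Lemma pairing_cst t X a :
  pairing P F (cst (Some t)) (cst T) X a =
  cond_exp P (F t) (integ (window (horizon t) X) (increment a)).
Proof.
rewrite /pairing sigma_stop_cst; congr cond_exp; apply/funext => w.
rewrite /integ /wsum; congr (lim (_ @ \oo)); apply/funext => n.
rewrite big_mkcond/=; apply: eq_bigr => i _; rewrite /window /horizon.
by case: ifP => //; rewrite mul0r.
Qed.

(** What is used of the elements of [D^e_{0,T}]: their increments are weights
    carried by [[0, T]], with a positive mass after each time of [[0, T]]. *)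
Definition admissible a := [/\ random_weight P (increment a),
  forall t, tle (Some t) T -> {ae P, forall w, 0 < mass (horizon t) (increment a) w} &
  {ae P, forall w, forall r, ~~ tle (Some r) T -> increment a r w = 0}].

Lemma measurable_increment a r : (forall t, measurable_fun setT (a t)) ->
  measurable_fun setT (increment a r).
Proof.
move=> ma; apply: measurable_funB => //.
by case: r => [|r] /=; [exact: measurable_cst|exact: ma].
Qed.

Lemma Dset_e_admissible a :
  Dset_e P F (cst (Some 0%N)) (cst T) a -> admissible a.
Proof.
move=> [[[Ra [b [[Rb b1] b0] ab]] _] apos].
have ma t : measurable_fun setT (a t) by have [] := Ra t.
have mb t : measurable_fun setT (b t) by have [] := Rb t.
have incE : {ae P, forall w, forall r, increment a r w =
    if tle (Some r) T then increment b r w else 0}.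
  apply: filterS ab => w ab' r; rewrite /increment.
  have abE t : a t w = b (tmin t T) w by rewrite ab'.
  case: r => [|r]; rewrite /= !abE; case: (T) => [n|] //=.
    by rewrite min0n.
  have [rn|nr] := leqP r.+1 n; first by rewrite (minn_idPl (ltnW rn)).
  by rewrite (minn_idPr _) ?subrr.
have mib r := measurable_increment r mb.
have mia r := measurable_increment r ma.
pose V w : \bar R := (\sum_(0 <= t <oo) `|increment b t w|%:E)%E.
have mV : measurable_fun setT V.
  apply: ge0_emeasurable_sum => n *; rewrite ?lee_fin//.
  by apply/measurable_EFinP; exact: measurableT_comp.
have V0 w : (0 <= V w)%E by apply: nneseries_ge0 => *; rewrite lee_fin.
have iV : P.-integrable setT V.
  apply/integrableP; split => //; under eq_integral do rewrite gee0_abs//.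
  exact: b1.
have Vfin := integrable_ae measurableT iV.
have key : {ae P, forall w, summable_weight (increment a ^~ w) /\
    ((integ (fun _ _ => 1) (increment a) w)%:E <= V w)%E}.
  apply: filterS3 incE b0 Vfin => w ia ib /(_ Logic.I) Vw.
  have ia0 i : 0 <= increment a i w by rewrite ia; case: ifP.
  have cb : cvgn (series (fun i => `|increment b i w|)).
    by apply: nnseries_is_cvg => //; rewrite ltey_eq Vw.
  have iab i : increment a i w <= `|increment b i w|.
    by rewrite ia; case: ifP => // _; exact: ler_norm.
  have ca : cvgn (series (increment a ^~ w)) by exact: series_le_cvg cb.
  split => //; rewrite /integ wsumE.
  rewrite (_ : series _ = series (increment a ^~ w)); last first.
    by congr series; apply/funext => i; rewrite /= mul1r.
  rewrite -EFin_lim//.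
  rewrite (_ : EFin \o _ = fun n => \sum_(0 <= i < n) (increment a i w)%:E)%E; last first.
    by apply/funext => n; rewrite /= sumEFin.
  by apply: lee_nneseries => i *; rewrite lee_fin.
have wa : random_weight P (increment a).
  split => //; first by apply: filterS key => w [].
  apply/integrableP; split.
    by apply/measurable_EFinP; apply: measurable_integ => // r; exact: measurable_cst.
  have /integrableP[_] := iV; apply: le_lt_trans.
  apply: ae_ge0_le_integral => //.
  - apply: measurableT_comp => //; apply/measurable_EFinP.
    by apply: measurable_integ => // r; exact: measurable_cst.
  - exact: measurableT_comp.
  - apply: filterS key => w [sw Vw] _; rewrite (gee0_abs (V0 w)) gee0_abs//.
    by rewrite /= lee_fin; apply: (wsum_ge0 sw (bounded_seq_cst 1)) => ?.
split => //.
- move=> t tT; apply: filterS2 (apos t) incE => w; rewrite (_ : tmin _ _ = t); last first.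
    by case: (T) tT => [n|]//= /minn_idPl.
  move=> + ia; suff -> : \big[+%R/0]_(t <= j <oo) increment a j w =
      mass (horizon t) (increment a) w by [].
  congr (lim (_ @ \oo)); apply/funext => n.
  rewrite (big_nat_widenl _ 0)//= big_mkcond/=; apply: eq_bigr => i _.
  rewrite /window /horizon ia; case: (t <= i)%N; case: (tle _ _) => /=; rewrite ?mul1r ?mul0r//.
- by apply: filterS incE => w ia r /negbTE rT; rewrite ia rT.
Qed.

End admissible.

(** * The utility process as a directed infimum of averages *)

Section utility_process.
Context {R : realType} {d : measure_display} {Omega : measurableType d}.
Variable P : probability Omega R.
Variable F : nat -> set (set Omega).
Hypothesis hF : filtration F.
Variable T : natbar.
Variable Q : set (nat -> Omega -> R).
Hypothesis Q0 : Q !=set0.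
Hypothesis adm : forall a, Q a -> admissible P T a.
Hypothesis stQ : stable_under_concatenation P F Q.
Implicit Types (f g h Z U : Omega -> R) (X Y a b c : nat -> Omega -> R) (C : set Omega).

Local Notation itg f := (P.-integrable setT (EFin \o f)).
Local Notation Ex f := (\int[P]_w f w).
Local Notation bproc := (bounded_process P).
Local Notation mass q u := (integ (window q (fun _ _ => 1)) u).
Local Notation ave t a := (average P (F t) (horizon T t) (increment a)).

Let sF t : sigma_algebra setT (F t). Proof. by case: hF. Qed.
Let FM t : F t `<=` measurable. Proof. by case: hF. Qed.
Let FF s t : (s <= t)%N -> F s `<=` F t. Proof. by case: hF => _ _; apply. Qed.

Local Notation phi t := (phi_of P F Q T t).

Lemma horizon_tle s t : (t <= s)%N -> tle (Some s) T -> tle (Some t) T.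
Proof. by case: (T) => [n|]//=; exact: leq_trans. Qed.

Lemma horizon_from t s : (t <= s)%N ->
  (fun r => horizon T t r && (s <= r)%N) = horizon T s.
Proof.
move=> ts; apply/funext => r; rewrite /horizon.
have [sr|] := leqP s r; last by rewrite andbF.
by rewrite (leq_trans ts sr) andbT.
Qed.

Lemma cond_exp_ae_eq t f g : itg f -> itg g -> {ae P, forall w, f w = g w} ->
  {ae P, forall w, cond_exp P (F t) f w = cond_exp P (F t) g w}.
Proof.
move=> if_ ig fg; have cf := cond_expP (sF t) (FM (t:=t)) if_.
have cg := cond_expP (sF t) (FM (t:=t)) ig.
have le1 := is_cond_exp_le (sF t) (FM (t:=t)) cf cg if_ ig.
have le2 := is_cond_exp_le (sF t) (FM (t:=t)) cg cf ig if_.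
have {}le1 : {ae P, forall w, cond_exp P (F t) f w <= cond_exp P (F t) g w}.
  by apply: le1; apply: filterS fg => w ->.
have {}le2 : {ae P, forall w, cond_exp P (F t) g w <= cond_exp P (F t) f w}.
  by apply: le2; apply: filterS fg => w ->.
exact: ae_le_anti le1 le2.
Qed.

(** On [C] the increments of a concatenation are those of [b] from [s] on, scaled
    by the ratio [h] of the conditional remaining masses. *)
Lemma increment_concatenation a b c s C (h := fun w =>
    pairing P F (cst (Some s)) (cst None) one_process a w /
    pairing P F (cst (Some s)) (cst None) one_process b w) :
  {ae P, forall w, 0 < pairing P F (cst (Some s)) (cst None) one_process b w} ->
  process_ae_eq P c (concatenation P F a b (cst (Some s)) C) ->
  {ae P, forall w, forall r, increment c r w =
    if (s <= r)%N && (w \in C) then h w * increment b r w else increment a r w}.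
Proof.
move=> pb0 cE; apply: filterS2 pb0 cE => w pb0 cE r.
have {}cE k : c k w = if (s <= k)%N && (w \in C) then
    before a s w + h w * (b k w - before b s w) else a k w.
  by rewrite cE /concatenation /= pb0 andbT.
rewrite /increment cE.
have bE : before c r w = if (s < r)%N && (w \in C) then
    before a s w + h w * (before b r w - before b s w) else before a r w.
  by case: r => [|r] //=; rewrite cE ltnS.
rewrite bE; have [wC|] := boolP (w \in C); last by rewrite !andbF.
rewrite !andbT; have [sr|sr|<-] := ssrnat.ltngtP s r.
- by ring.
- by [].
- by ring.
Qed.

(** Concatenation at a deterministic time, read on averages. *)
Lemma stable_average a b s C : Q a -> Q b -> tle (Some s) T -> F s C ->
  exists2 c, Q c & forall t X, (t <= s)%N -> bproc X ->
    {ae P, forall w, ave t c X w = ave t a (replace_from s C (ave s b X) X) w}.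
Proof.
move=> Qa Qb sT FC.
have [c Qc cE] : exists2 c, Q c & process_ae_eq P c (concatenation P F a b (cst (Some s)) C).
  apply: stQ => //.
  - move=> t /=; have [st|ts] := leqP s t.
      rewrite (_ : [set _ | _] = setT); last by apply/seteqP.
      by rewrite -setC0 -setTD; case: (sF t) => F0 FC' _; exact: FC'.
    rewrite (_ : [set _ | _] = set0); first by case: (sF t).
    by apply/seteqP; split => w //=; rewrite leqNgt ts.
  - by apply: aeW.
  - by rewrite sigma_stop_cst.
exists c => // t X ts bX.
have [wa pa za] := adm Qa; have [wb pb zb] := adm Qb; have [wc pc zc] := adm Qc.
have tT := horizon_tle ts sT.
have pE u : {ae P, forall w, forall r, ~~ tle (Some r) T -> increment u r w = 0} ->
   random_weight P (increment u) ->
   {ae P, forall w, pairing P F (cst (Some s)) (cst None) one_process u w =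
     cond_exp P (F s) (mass (horizon T s) (increment u)) w}.
  move=> zu wu; rewrite (pairing_cst P hF None); apply: cond_exp_ae_eq.
  - by apply: itg_window => //; exact: bounded_process_cst.
  - exact: itg_mass.
  apply: filterS zu => w zu; congr (lim (_ @ \oo)); apply/funext => n.
  apply: eq_bigr => r _; rewrite /window /horizon /= andbT.
  have [sr|//] := leqP s r; rewrite /=; case: ifPn => // /zu ->.
  by rewrite !mulr0.
have pEa := pE a za wa; have pEb := pE b zb wb.
have cb := cond_mass_gt0 (sF s) (FM (t:=s)) wb (pb _ sT).
have pb0 : {ae P, forall w, 0 < pairing P F (cst (Some s)) (cst None) one_process b w}.
  by apply: filterS2 pEb cb => w ->.
have zE := increment_concatenation pb0 cE.
have i1 u : random_weight P (increment u) -> measurable_wrt (F s)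
     (pairing P F (cst (Some s)) (cst None) one_process u).
  move=> wu; rewrite (pairing_cst P hF None).
  have i2 : itg (integ (window (horizon None s) one_process) (increment u)).
    by apply: itg_window => //; exact: bounded_process_cst.
  by have [] := cond_expP (sF s) (FM (t:=s)) i2.
have mh := measurable_wrt_div (i1 a wa) (i1 b wb).
have := @average_concat _ _ _ P (F t) (F s) (sF t) (FM (t:=t)) (sF s) (FM (t:=s))
  (FF ts) (horizon T t) s C _ _ _ _ X wa wb wc (pa _ tT) (pc _ tT).
rewrite (horizon_from ts); apply; [exact: pb|exact: FC|exact: mh|exact: zE| |exact: bX].
by apply: filterS3 pEa pEb cb => w -> -> cb0; rewrite divfK// lt0r_neq0.
Qed.

Let wt a : Q a -> random_weight P (increment a). Proof. by case/adm. Qed.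
Let ms t a : Q a -> tle (Some t) T ->
  {ae P, forall w, 0 < mass (horizon T t) (increment a) w}.
Proof. by case/adm => _ + _; apply. Qed.

Let ave_Linfty t a X (Qa : Q a) (tT : tle (Some t) T) (bX : bproc X) :
    Linfty P (F t) (ave t a X) :=
  average_Linfty (sF t) (FM (t:=t)) (wt Qa) (ms Qa tT) bX.

Let ave_measurable t a X (Qa : Q a) (tT : tle (Some t) T) (bX : bproc X) :
    measurable_fun setT (ave t a X) := (ave_Linfty Qa tT bX).1.1.

Let min_le_l (x y : R) : Num.min x y <= x. Proof. by rewrite ge_min lexx. Qed.
Let min_le_r (x y : R) : Num.min x y <= y. Proof. by rewrite ge_min lexx orbT. Qed.

Let min_lN (x y : R) : ~ y < x -> Num.min x y = x.
Proof. by move=> /negP; rewrite -leNgt => /min_l. Qed.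

Lemma phi_ofE t X : phi t X = ess_inf_family P [set Z | exists2 a, Q a & Z = ave t a X].
Proof.
congr ess_inf_family; apply/seteqP; split => Z [a Qa ->]; exists a => //.
  by apply/funext => w; rewrite !pairing_cst.
by apply/funext => w; rewrite !pairing_cst.
Qed.

(** At the time of the replacement itself, the average is [U] on [C]. *)
Lemma replace_average t a C U X : Q a -> tle (Some t) T -> F t C -> Linfty P (F t) U ->
  bproc X ->
  {ae P, forall w, ave t a (replace_from t C U X) w =
    if w \in C then U w else ave t a X w}.
Proof.
move=> Qa tT FC LU bX.
have LC := Linfty_indic P (sF t) (FM (t:=t)) FC.
have LCU := LinftyM LC LU.
have mC : measurable C by exact: FM FC.
have b1 := bounded_process_cst P (1 : R).
have LN : Linfty P (F t) (fun w => 1 * 1 + (- 1) * \1_C w).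
  by apply: Linfty_lin => //; exact: Linfty_cst.
have bR : bproc (replace_from t C U X).
  by apply: bounded_replace_from => //; [exact: LU.1.1|exact: LU.2].
have bL : bproc (fun r w => (\1_C \* U) w * 1 + (1 * 1 + (- 1) * \1_C w) * X r w).
  by apply: bounded_process_lin => //; [exact: LCU.1.1|exact: LN.1.1|exact: LCU.2|exact: LN.2].
have H1 := average_lin (sF t) (FM (t:=t)) (wt Qa) (ms Qa tT) LCU LN b1 bX.
have H2 := average1 (sF t) (FM (t:=t)) (wt Qa) (ms Qa tT).
have H3 : {ae P, forall w, ave t a (replace_from t C U X) w =
    ave t a (fun r w => (\1_C \* U) w * 1 + (1 * 1 + (- 1) * \1_C w) * X r w) w}.
  apply: (eq_average (sF t) (FM (t:=t)) (wt Qa) (ms Qa tT) bR bL).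
  apply: aeW => w r /andP[tr _]; rewrite /replace_from tr /= !indicE.
  by case: (w \in C) => /=; ring.
apply: filterS3 H1 H2 H3 => w H1' H2' ->; rewrite H1' H2' /= !indicE.
by case: (w \in C) => /=; ring.
Qed.

(** Concatenate [b] to [a] where the [b]-average is the smaller one. *)
Lemma average_directed t a b X : Q a -> Q b -> tle (Some t) T -> bproc X ->
  exists2 c, Q c &
    {ae P, forall w, ave t c X w = Num.min (ave t a X w) (ave t b X w)}.
Proof.
move=> Qa Qb tT bX.
have La := ave_Linfty Qa tT bX; have Lb := ave_Linfty Qb tT bX.
have [C FC CE] := L0_lt (sF t) Lb.1 La.1.
have [c Qc cE] := stable_average Qa Qb tT FC.
exists c => //; have H1 := cE t X (leqnn t) bX.
have H2 := replace_average Qa tT FC Lb bX.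
apply: filterS3 H1 H2 CE => w -> -> CE'.
case: ifPn => [/set_mem/CE' ba|/negP nC]; first by rewrite (min_r (ltW ba)).
by apply/esym/min_lN => /CE'.2 /mem_set.
Qed.

(** The essential infimum of the averages is the limit of a decreasing sequence of
    averages whose expectations tend to their infimum over [Q]. *)
Lemma ex_ess_inf_sequence t X : tle (Some t) T -> bproc X ->
  exists b_ : nat -> nat -> Omega -> R, exists Z : Omega -> R,
  [/\ forall n, Q (b_ n),
      {ae P, forall w, ave t (b_ n) X w @[n --> \oo] --> Z w},
      measurable_fun setT Z &
      is_ess_inf_family P [set Z | exists2 a, Q a & Z = ave t a X] Z].
Proof.
move=> tT bX; have [_ [m Xm]] := bX.
have am a : Q a -> {ae P, forall w, `|ave t a X w| <= m}.
  move=> Qa; apply: (average_norm (sF t) (FM (t:=t)) (wt Qa) (ms Qa tT) bX).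
  by apply: filterS Xm => w Xm r _.
have ia a : Q a -> itg (ave t a X).
  by move=> Qa; exact: (itg_bounded (ave_measurable Qa tT bX) (am _ Qa)).
pose S := [set Ex (ave t a X) | a in Q].
have Slb : has_inf S.
  split; first by have [a Qa] := Q0; exists (Ex (ave t a X)), a.
  exists (Ex (fun=> - m)) => _ [a Qa <-]; apply: Ex_ae_le; [exact: itg_cst|exact: ia|].
  by apply: filterS (am _ Qa) => w; rewrite ler_norml => /andP[].
have Sinf a : Q a -> inf S <= Ex (ave t a X).
  by move=> Qa; apply: ge_inf; [exact: Slb.2|exists a].
have /choice[b' b'P] : forall n : nat, exists b, Q b /\
    Ex (ave t b X) < inf S + n.+1%:R^-1.
  move=> n; have [|_ [a Qa <-] H] := @inf_adherent _ S (n.+1%:R^-1) _ Slb.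
    by rewrite invr_gt0.
  by exists a.
have /choice[mt mtP] : forall ab : (nat -> Omega -> R) * (nat -> Omega -> R),
    exists c, Q ab.1 -> Q ab.2 -> Q c /\
    {ae P, forall w, ave t c X w = Num.min (ave t ab.1 X w) (ave t ab.2 X w)}.
  move=> [a b] /=.
  have [[Qa Qb]|nQ] := pselect (Q a /\ Q b); last first.
    by exists a => Qa Qb; exfalso; apply: nQ.
  by have [c Qc cE] := average_directed Qa Qb tT bX; exists c.
(* [mt] selects a directed minimum of two elements of [Q]; iterating it makes the
   minimizing sequence [b'] decreasing. *)
pose b_ := fix b_ n := if n is k.+1 then mt (b_ k, b' k.+1) else b' 0%N.
have Qb' n : Q (b' n) by have [] := b'P n.
have Qb n : Q (b_ n).
  by elim: n => [|n IH] /=; [exact: Qb'|have [] := mtP (b_ n, b' n.+1) IH (Qb' _)].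
have bS n : {ae P, forall w, ave t (b_ n.+1) X w =
    Num.min (ave t (b_ n) X w) (ave t (b' n.+1) X w)}.
  by have [] := mtP (b_ n, b' n.+1) (Qb _) (Qb' _).
have bb' n : {ae P, forall w, ave t (b_ n) X w <= ave t (b' n) X w}.
  case: n => [|n]; first exact: aeW.
  by apply: filterS (bS n) => w ->; exact: min_le_r.
pose Z w := limn (fun n => ave t (b_ n) X w).
have mZ : measurable_fun setT Z.
  by apply: (@measurable_fun_lim _ _ _ (fun n => ave t (b_ n) X)) => n; exact: ave_measurable.
have /ae_foralln allS := bS.
have /ae_foralln allm : forall n, {ae P, forall w, `|ave t (b_ n) X w| <= m}.
  by move=> n; exact: am.
have bZ : {ae P, forall w, ave t (b_ n) X w @[n --> \oo] --> Z w}.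
  apply: filterS2 allS allm => w Sw mw; apply: nonincreasing_is_cvgn.
    by apply/nonincreasing_seqP => n; rewrite Sw; exact: min_le_l.
  by exists (- m) => _ [n _ <-]; have := mw n; rewrite ler_norml => /andP[].
exists b_, Z; split => //; split => //; last first.
  move=> Z' mZ' Z'le.
  have /ae_foralln Z'all : forall n, {ae P, forall w, Z' w <= ave t (b_ n) X w}.
    by move=> n; apply: Z'le; exists (b_ n).
  apply: filterS2 bZ Z'all => w bZw Z'w; rewrite -(cvg_lim _ bZw)//.
  apply: limr_ge; first by apply/cvg_ex; eexists; exact: bZw.
  exact: nearW.
move=> _ [a Qa ->].
have Zm : {ae P, forall w, `|Z w| <= m}.
  apply: filterS2 bZ allm => w bZw mw.
  have : `|ave t (b_ n) X w| @[n --> \oo] --> `|Z w| by exact: cvg_norm.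
  move=> /cvg_lim <-//; apply: limr_le; last exact: nearW.
  by apply/cvg_ex; eexists; exact: (cvg_norm bZw).
have iZ : itg Z by exact: itg_bounded Zm.
have mmin f g : measurable_fun setT f -> measurable_fun setT g ->
    measurable_fun setT (fun w => Num.min (f w) (g w)).
  by move=> mf mg; exact: measurable_minr.
have imin f g : {ae P, forall w, `|f w| <= m} -> {ae P, forall w, `|g w| <= m} ->
    {ae P, forall w, `|Num.min (f w) (g w)| <= m}.
  by move=> fm gm; apply: filterS2 fm gm => w; rewrite /Num.min; case: ifP.
have mb n := ave_measurable (Qb n) tT bX.
have ma := ave_measurable Qa tT bX.
(* [Z] has mean at most [inf S], and so has the minimum of [Z] with any average at
   least that mean, by directedness; thus [Z] lies below that average. *)
have EZ : Ex Z <= inf S.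
  have H : Ex (ave t (b_ n) X) @[n --> \oo] --> Ex Z.
    exact: (Ex_dominated mb mZ (itg_cst P m) bZ allm).
  rewrite -(cvg_lim _ H)//.
  have Hh : inf S + n.+1%:R^-1 @[n --> \oo] --> inf S.
    rewrite -[X in _ --> X]addr0; apply: cvgD; first exact: cvg_cst.
    exact: cvg_harmonic.
  rewrite -[leRHS](cvg_lim _ Hh)//; apply: ler_lim.
  - by apply/cvg_ex; eexists; exact: H.
  - by apply/cvg_ex; eexists; exact: Hh.
  apply: nearW => n; apply: le_trans (ltW (b'P n).2).
  by apply: Ex_ae_le; [exact: ia|exact: ia|exact: bb'].
pose V w := Num.min (Z w) (ave t a X w).
have mV : measurable_fun setT V by exact: mmin.
have Vm : {ae P, forall w, `|V w| <= m} by exact: (imin _ _ Zm (am _ Qa)).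
have EV : inf S <= Ex V.
  pose W n w := Num.min (ave t (b_ n) X w) (ave t a X w).
  have mW n : measurable_fun setT (W n) := mmin _ _ (mb n) ma.
  have /ae_foralln Wm n : {ae P, forall w, `|W n w| <= m} :=
    imin _ _ (am _ (Qb n)) (am _ Qa).
  have bV : {ae P, forall w, W n w @[n --> \oo] --> V w}.
    apply: filterS bZ => w bZw; rewrite /W /V.
    have E (x y : R) : Num.min x y = (x + y - `|x - y|) / 2 by rewrite minr_absE.
    rewrite E; under eq_fun do rewrite E.
    apply: cvgMr_tmp; apply: cvgB; first by apply: cvgD => //; exact: cvg_cst.
    by apply: cvg_norm; apply: cvgB => //; exact: cvg_cst.
  have H := Ex_dominated mW mV (itg_cst P m) bV Wm.
  rewrite -(cvg_lim _ H)//; apply: limr_ge; first by apply/cvg_ex; eexists; exact: H.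
  apply: nearW => n; have [c Qc cE] := average_directed (Qb n) Qa tT bX.
  have E : Ex (ave t c X) = Ex (W n) := Ex_ae_eq (ave_measurable Qc tT bX) (mW n) cE.
  by rewrite -E; exact: Sinf.
have iV : itg V by exact: itg_bounded Vm.
have ZV0 : {ae P, forall w, 0 <= (Z \- V) w}.
  by apply: aeW => w; rewrite /= subr_ge0; exact: min_le_l.
have EZV : Ex (Z \- V) <= 0 by rewrite ExB// subr_le0 (le_trans EZ).
have := Ex_le0_ae0 (itgB iZ iV) ZV0 EZV.
by apply: filterS => w /eqP; rewrite /= subr_eq0 => /eqP ->; exact: min_le_r.
Qed.

(** [phi t X] satisfies the definition of the essential infimum, so that the
    default value is never taken. *)
Lemma phi_ess_inf t X : tle (Some t) T -> bproc X ->
  is_ess_inf_family P [set Z | exists2 a, Q a & Z = ave t a X] (phi t X).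
Proof.
move=> tT bX; have [_ [Z [_ _ _ HZ]]] := ex_ess_inf_sequence tT bX.
rewrite phi_ofE; exact: (@xgetPex _ _ [set Z | is_ess_inf_family P _ Z] (ex_intro _ Z HZ)).
Qed.

Lemma phi_measurable t X : tle (Some t) T -> bproc X -> measurable_fun setT (phi t X).
Proof. by move=> tT bX; have [] := phi_ess_inf tT bX. Qed.

Lemma phi_le t a X : tle (Some t) T -> bproc X -> Q a ->
  {ae P, forall w, phi t X w <= ave t a X w}.
Proof. by move=> tT bX Qa; have [_ + _] := phi_ess_inf tT bX; apply; exists a. Qed.

Lemma phi_ge t X Z : tle (Some t) T -> bproc X -> measurable_fun setT Z ->
  (forall a, Q a -> {ae P, forall w, Z w <= ave t a X w}) ->
  {ae P, forall w, Z w <= phi t X w}.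
Proof.
move=> tT bX mZ H; have [_ _ Hmax] := phi_ess_inf tT bX.
by apply: Hmax => // _ [a Qa ->]; exact: H.
Qed.

Lemma phi_limit t X : tle (Some t) T -> bproc X ->
  exists2 b_ : nat -> nat -> Omega -> R, forall n, Q (b_ n) &
    {ae P, forall w, ave t (b_ n) X w @[n --> \oo] --> phi t X w}.
Proof.
move=> tT bX; have [b_ [Z [Qb bZ mZ [_ Zle Zge]]]] := ex_ess_inf_sequence tT bX.
exists b_ => //; have mphi := phi_measurable tT bX.
have H1 : {ae P, forall w, Z w <= phi t X w}.
  by apply: phi_ge => // a Qa; apply: Zle; exists a.
have H2 : {ae P, forall w, phi t X w <= Z w}.
  by apply: Zge => // _ [a Qa ->]; exact: phi_le.
by apply: filterS2 bZ (ae_le_anti H1 H2) => w + <-.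
Qed.

Lemma phi_norm t X (m : R) : tle (Some t) T -> bproc X ->
  {ae P, forall w, forall r, horizon T t r -> `|X r w| <= m} ->
  {ae P, forall w, `|phi t X w| <= m}.
Proof.
move=> tT bX Xm; have [b_ Qb bphi] := phi_limit tT bX.
have /ae_foralln allm : forall n, {ae P, forall w, `|ave t (b_ n) X w| <= m}.
  by move=> n; exact: (average_norm (sF t) (FM (t:=t)) (wt (Qb n)) (ms (Qb n) tT) bX).
apply: filterS2 bphi allm => w bw mw.
have H : `|ave t (b_ n) X w| @[n --> \oo] --> `|phi t X w| by exact: cvg_norm.
rewrite -(cvg_lim _ H)//; apply: limr_le; last exact: nearW.
by apply/cvg_ex; eexists; exact: H.
Qed.

Lemma phi_Linfty t X : tle (Some t) T -> bproc X -> Linfty P (F t) (phi t X).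
Proof.
move=> tT bX; have [b_ Qb bphi] := phi_limit tT bX; split.
  apply: (L0_lim _ (phi_measurable tT bX) bphi) => n.
  exact: (ave_Linfty (Qb n) tT bX).1.
by have [_ [m Xm]] := bX; exists m; apply: phi_norm => //; apply: filterS Xm.
Qed.

Lemma phi_mono t X Y : tle (Some t) T -> bproc X -> bproc Y ->
  {ae P, forall w, forall r, horizon T t r -> X r w <= Y r w} ->
  {ae P, forall w, phi t X w <= phi t Y w}.
Proof.
move=> tT bX bY XY; apply: phi_ge => //; first exact: phi_measurable.
move=> a Qa; have H1 := phi_le tT bX Qa.
have H2 := le_average (sF t) (FM (t:=t)) (wt Qa) (ms Qa tT) bX bY XY.
by apply: filterS2 H1 H2 => w; exact: le_trans.
Qed.

Lemma phi_eq t X Y : tle (Some t) T -> bproc X -> bproc Y ->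
  {ae P, forall w, forall r, horizon T t r -> X r w = Y r w} ->
  {ae P, forall w, phi t X w = phi t Y w}.
Proof.
move=> tT bX bY XY.
have le1 : {ae P, forall w, phi t X w <= phi t Y w}.
  by apply: phi_mono => //; apply: filterS XY => w XY r pr; rewrite XY.
have le2 : {ae P, forall w, phi t Y w <= phi t X w}.
  by apply: phi_mono => //; apply: filterS XY => w XY r pr; rewrite XY.
exact: ae_le_anti le1 le2.
Qed.

(** * Coherence and relevance *)

Let le_div (l x v : R) : 0 < l -> v <= l * x -> v / l <= x.
Proof. by move=> l0; rewrite ler_pdivrMr// mulrC. Qed.

Let le_convex (l x y x' y' : R) : x <= x' -> y <= y' -> 0 <= l <= 1 ->
  l * x + (1 - l) * y <= l * x' + (1 - l) * y'.
Proof.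
move=> xx yy /andP[l0 l1].
by apply: lerD; apply: ler_wpM2l => //; rewrite subr_ge0.
Qed.

Lemma Rinfty_between_bounded t X :
  Rinfty_between P F (cst (Some t)) (cst T) X -> bproc X.
Proof.
move=> [RX [Y [_ [m Ym]] XY]]; split => [r|]; first by have [] := RX r.
exists m; apply: filterS2 Ym XY => w Ym XY r; rewrite XY /stop_proj.
by case: ifP => _; [exact: Ym|rewrite normr0 (le_trans _ (Ym 0%N))].
Qed.

(** Stated for any [Y] which agrees with [l X + m] on the times of the average. *)
Lemma average_affine t a X l m : Q a -> tle (Some t) T -> bproc X ->
  Linfty P (F t) l -> Linfty P (F t) m -> forall Y, bproc Y ->
  {ae P, forall w, forall r, horizon T t r -> Y r w = l w * X r w + m w} ->
  {ae P, forall w, ave t a Y w = l w * ave t a X w + m w}.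
Proof.
move=> Qa tT bX Ll Lm Y bY YE.
have b1 := bounded_process_cst P (1 : R).
have H1 := average_lin (sF t) (FM (t:=t)) (wt Qa) (ms Qa tT) Ll Lm bX b1.
have H2 := average1 (sF t) (FM (t:=t)) (wt Qa) (ms Qa tT).
have bL : bproc (fun r w => l w * X r w + m w * 1).
  by apply: bounded_process_lin => //; [exact: Ll.1.1|exact: Lm.1.1|exact: Ll.2|exact: Lm.2].
have H3 : {ae P, forall w, ave t a Y w = ave t a (fun r w => l w * X r w + m w * 1) w}.
  apply: (eq_average (sF t) (FM (t:=t)) (wt Qa) (ms Qa tT) bY bL).
  by apply: filterS YE => w YE r pr; rewrite YE// mulr1.
by apply: filterS3 H1 H2 H3 => w -> -> ->; rewrite mulr1.
Qed.

Lemma bounded_process_affine t X l m : bproc X ->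
  Linfty P (F t) l -> Linfty P (F t) m -> bproc (fun r w => l w * X r w + m w).
Proof.
move=> bX Ll Lm.
rewrite (_ : (fun _ => _) = fun r w => l w * X r w + m w * 1).
  apply: bounded_process_lin => //; [exact: Ll.1.1|exact: Lm.1.1|exact: Ll.2|exact: Lm.2|].
  exact: bounded_process_cst.
by apply/funext => r; apply/funext => w; rewrite mulr1.
Qed.

(** For the upper bound, [phi t (l X) / l] is a lower bound of the averages of [X]
    where [l > 0]. *)
Lemma phi_homogeneous t X l : tle (Some t) T -> bproc X -> Linfty P (F t) l ->
  {ae P, forall w, 0 <= l w} ->
  {ae P, forall w, phi t (fun r w => l w * X r w) w = l w * phi t X w}.
Proof.
move=> tT bX Ll l0; have L0' := Linfty_cst P (sF t) (FM (t:=t)) 0.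
set Y : nat -> Omega -> R := fun r w => l w * X r w.
have bY : bproc Y.
  have := bounded_process_affine bX Ll L0'; congr bounded_process.
  by apply/funext => r; apply/funext => w; rewrite addr0.
have YE a : Q a -> {ae P, forall w, ave t a Y w = l w * ave t a X w}.
  move=> Qa; have H : {ae P, forall w, ave t a Y w = l w * ave t a X w + 0}.
    apply: (average_affine Qa tT bX Ll L0' bY).
    by apply: aeW => w r _; rewrite addr0.
  by apply: filterS H => w ->; rewrite addr0.
have mX := phi_measurable tT bX.
have mY := phi_measurable tT bY.
have ml := Ll.1.1.
apply: ae_le_anti; last first.
  apply: (phi_ge tT bY); first exact: measurable_funM.
  move=> a Qa; have H1 := phi_le tT bX Qa.
  by apply: filterS3 H1 (YE a Qa) l0 => w H1' -> l0'; exact: ler_wpM2l.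
have ml0 : measurable_fun setT (fun w => 0 < l w).
  by apply: measurable_fun_ltr => //; exact: measurable_cst.
have mV : measurable_fun setT (fun w => phi t Y w / l w).
  apply: measurable_funM; first exact: mY.
  by apply: (measurableT_comp (@measurable_inv R)); exact: ml.
pose Z w := if 0 < l w then phi t Y w / l w else phi t X w.
have ZX : {ae P, forall w, Z w <= phi t X w}.
  apply: (phi_ge tT bX).
    exact: (measurable_fun_ifT ml0 mV mX).
  move=> a Qa; have H1 := phi_le tT bX Qa.
  have H2 := phi_le tT bY Qa.
  apply: filterS3 H1 H2 (YE a Qa) => w H1' H2' E; rewrite /Z.
  by case: ifPn => lw; [apply: (le_div lw); rewrite -E; exact: H2'|exact: H1'].
have [a Qa] := Q0; have H2 := phi_le tT bY Qa.
apply: filterS3 (filterI ZX l0) H2 (YE a Qa) => w [ZX' l0'] H2' E.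
move: ZX'; rewrite /Z; case: ifPn => [lw|]; first by rewrite ler_pdivrMr// mulrC.
rewrite -leNgt => lw _; have E0 : l w = 0 by apply: le_anti; rewrite lw l0'.
by move: H2'; rewrite E E0 !mul0r.
Qed.

Lemma phi_local t X A : tle (Some t) T -> bproc X -> F t A ->
  {ae P, forall w, phi t (fun r w => \1_A w * X r w) w = \1_A w * phi t X w}.
Proof.
move=> tT bX FA; apply: phi_homogeneous => //; first exact: Linfty_indic.
by apply: aeW => w; rewrite indicE; case: (w \in A).
Qed.

Lemma phi_translation t X m Y : tle (Some t) T -> bproc X -> Linfty P (F t) m ->
  bproc Y ->
  {ae P, forall w, forall r, horizon T t r -> Y r w = X r w + m w} ->
  {ae P, forall w, phi t Y w = phi t X w + m w}.
Proof.
move=> tT bX Lm bY YE; have L1 := Linfty_cst P (sF t) (FM (t:=t)) 1.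
have aE a : Q a -> {ae P, forall w, ave t a Y w = ave t a X w + m w}.
  move=> Qa; have H : {ae P, forall w, ave t a Y w = 1 * ave t a X w + m w}.
    apply: (average_affine Qa tT bX L1 Lm bY).
    by apply: filterS YE => w YE r pr; rewrite YE// mul1r.
  by apply: filterS H => w ->; rewrite mul1r.
have mX := phi_measurable tT bX.
have mY := phi_measurable tT bY.
have mm := Lm.1.1.
apply: ae_le_anti; last first.
  apply: (phi_ge tT bY); first exact: measurable_funD.
  move=> a Qa; have H1 := phi_le tT bX Qa.
  by apply: filterS2 H1 (aE a Qa) => w H1' ->; rewrite lerD2r.
have H : {ae P, forall w, phi t Y w - m w <= phi t X w}.
  apply: (phi_ge tT bX); first exact: measurable_funB.
  move=> a Qa; have H1 := phi_le tT bY Qa.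
  by apply: filterS2 H1 (aE a Qa) => w H1' E; rewrite lerBlDr -E.
by apply: filterS H => w; rewrite lerBlDr.
Qed.

Lemma phi_concave t X Y l : tle (Some t) T -> bproc X -> bproc Y ->
  Linfty P (F t) l -> {ae P, forall w, 0 <= l w <= 1} ->
  {ae P, forall w, l w * phi t X w + (1 - l w) * phi t Y w
      <= phi t (fun r w => l w * X r w + (1 - l w) * Y r w) w}.
Proof.
move=> tT bX bY Ll l01.
have Ll' : Linfty P (F t) (fun w => 1 - l w).
  rewrite (_ : (fun w => _) = fun w => 1 * 1 + (- 1) * l w).
    by apply: Linfty_lin => //; exact: Linfty_cst.
  by apply/funext => w; ring.
have bL : bproc (fun r w => l w * X r w + (1 - l w) * Y r w).
  by apply: bounded_process_lin => //; [exact: Ll.1.1|exact: Ll'.1.1|exact: Ll.2|exact: Ll'.2].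
have mX := phi_measurable tT bX.
have mY := phi_measurable tT bY.
apply: (phi_ge tT bL).
  by apply: measurable_funD; apply: measurable_funM => //; [exact: Ll.1.1|exact: Ll'.1.1].
move=> a Qa; have H1 := phi_le tT bX Qa.
have H2 := phi_le tT bY Qa.
have H3 := average_lin (sF t) (FM (t:=t)) (wt Qa) (ms Qa tT) Ll Ll' bX bY.
by apply: filterS3 (filterI H1 H2) H3 l01 => w [H1' H2'] ->; exact: le_convex.
Qed.

Lemma coherent_phi : coherent_utility_process P F T (phi_of P F Q T).
Proof.
move=> t tT; split; last first.
  move=> X l /Rinfty_between_bounded bX; rewrite sigma_stop_cst// => Ll l0.
  exact: phi_homogeneous.
split; last first.
  move=> X Y l /Rinfty_between_bounded bX /Rinfty_between_bounded bY.
  by rewrite sigma_stop_cst// => Ll l0; exact: phi_concave.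
split.
- move=> X /Rinfty_between_bounded bX; rewrite sigma_stop_cst//.
  exact: phi_Linfty.
- move=> X Y /Rinfty_between_bounded bX /Rinfty_between_bounded bY XY.
  apply: (phi_eq tT bX bY).
  by apply: filterS XY => w XY r _; rewrite XY.
- move=> X A /Rinfty_between_bounded bX; rewrite sigma_stop_cst// => FA.
  exact: phi_local.
- move=> X Y /Rinfty_between_bounded bX /Rinfty_between_bounded bY XY.
  apply: (phi_mono tT bX bY).
  by apply: filterS XY => w XY r _; rewrite XY.
- move=> X m /Rinfty_between_bounded bX; rewrite sigma_stop_cst// => Lm.
  have bI : bproc (ind_from (cst (Some t))).
    split => [r|].
      exact: (measurable_cst (if (t <= r)%N then 1 else 0 : R)).
    by exists 1; apply: aeW => w r; rewrite /ind_from; case: ifP; rewrite ?normr1 ?normr0.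
  have L1 := Linfty_cst P (sF t) (FM (t:=t)) 1.
  apply: (phi_translation tT bX Lm).
    rewrite (_ : (fun _ => _) = fun r w => 1 * X r w + m w * ind_from (cst (Some t)) r w).
      by apply: bounded_process_lin => //; [exact: Lm.1.1|exact: L1.2|exact: Lm.2].
    by apply/funext => r; apply/funext => w; rewrite mul1r.
  by apply: aeW => w r /andP[tr _]; rewrite /ind_from /= tr mulr1.
Qed.

Lemma relevant_phi : relevant_process P F T (phi_of P F Q T).
Proof.
move=> t tT eps s A eps0 [mA _].
set u := tmin s T; set Y := stop_proj _ _ _.
(* On [[t, T]] the process is [-eps 1_A] from time [v] on. *)
pose v := maxn t u.
have uT : tle (Some u) T.
  by rewrite /u; case: (T) => [n|]//=; exact: geq_minr.
have vT : tle (Some v) T by rewrite /v /maxn; case: ifP.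
have YE r w : horizon T t r -> Y r w = if (u <= r)%N then - eps * \1_A w else 0.
  move=> /andP[tr rT]; rewrite /Y /stop_proj /ind_from /= tr.
  have -> : tmin r T = r by case: (T) rT => [n|]//= /minn_idPl.
  by case: ifP; rewrite ?mulr1 ?mulr0.
have bY : bproc Y.
  have Y1 r : Y r = fun w =>
      (if (t <= r)%N && (u <= tmin r T)%N then - eps else 0) * \1_A w.
    apply/funext => w; rewrite /Y /stop_proj /ind_from /=.
    by case: (t <= r)%N => /=; [case: (u <= _)%N => /=|]; rewrite ?mulr1 ?mulr0 ?mul0r.
  split => [r|].
    rewrite Y1; apply: measurable_funM; first exact: measurable_cst.
    exact: measurable_indic.
  have e0 := ltW eps0; exists eps; apply: aeW => w r; rewrite Y1 normrM indicE.
  by case: ifP => _; case: (w \in A);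
    rewrite /= ?normrN ?(ger0_norm e0) ?normr1 ?normr0 ?mulr1 ?mulr0.
have [a Qa] := Q0; have LU := average_Linfty (sF t) (FM (t:=t)) (wt Qa) (ms Qa tT) bY.
have H1 := phi_le tT bY Qa.
have [[_ su _] _ _] := adm Qa.
set U := ave t a Y in LU H1; set N := mass (horizon T t) (increment a).
have N0 : {ae P, forall w, 0 < N w} := ms Qa tT.
set M := mass (horizon T v) (increment a).
have M0 : {ae P, forall w, 0 < M w} := ms Qa vT.
have YI : {ae P, forall w, integ (window (horizon T t) Y) (increment a) w = - eps * \1_A w * M w}.
  have bv := bounded_window (horizon T v) (bounded_process_cst P (1 : R)).
  apply: filterS2 su (bounded_process_ae bv) => w su' bv'.
  rewrite -(wsumZ _ su' bv'); congr (wsum _ _); apply/funext => r.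
  rewrite /window /horizon -/(horizon T t r).
  case: (boolP (horizon T t r)) => hr.
    rewrite YE// /v geq_max; case/andP: hr => -> -> /=; rewrite andbT.
    by case: ifP; rewrite ?mulr1 ?mulr0.
  rewrite [X in if X then _ else _](_ : _ = false) ?mulr0//.
  apply: contraNF hr; rewrite /v geq_max => /andP[/andP[tr _] rT].
  by rewrite /horizon tr rT.
(* [D] is the set where the average [U] is negative.  On its complement the two
   parts of the excess are nonpositive and have mean 0, so they vanish; but the
   first one is negative on [A]. *)
have [D FD DE] := L0_lt (sF t) LU.1 (L0_cst P (sF t) (FM (t:=t)) 0).
have FD' : F t (~` D) by rewrite -setTD; case: (sF t) => _ + _; apply.
have mD' : measurable (~` D) by exact: FM FD'.
have iE := itg_indic mD' (itg_excess (horizon T t) (wt Qa) bY LU).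
have E0 : Ex (\1_(~` D) \* excess (horizon T t) (increment a) Y U) = 0.
  apply: (average_excess (sF t) (FM (t:=t)) (wt Qa) (ms Qa tT) bY).
  exact: Linfty_indic.
have key : {ae P, forall w, 0 <= (\- (\1_(~` D) \* excess (horizon T t) (increment a) Y U)) w}.
  apply: filterS3 (filterI N0 M0) DE YI => w [N0' M0'] DE' YI'.
  rewrite /= /excess YI' indicE; have [/set_mem/= wD|_] := boolP (w \in ~` D); last first.
    by rewrite mul0r oppr0.
  have U0 : 0 <= U w by rewrite leNgt; apply/negP => /DE'.
  rewrite mul1r opprB !mulNr opprK -/N; apply: addr_ge0; first exact: mulr_ge0 U0 (ltW N0').
  apply: mulr_ge0 (ltW M0'); apply: mulr_ge0 (ltW eps0) _.
  by rewrite indicE; case: (w \in A).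
have EN : Ex (\- (\1_(~` D) \* excess (horizon T t) (increment a) Y U)) <= 0.
  rewrite (_ : \- _ = fun w => -1 * (\1_(~` D) \* excess (horizon T t) (increment a) Y U) w).
    by rewrite ExZ// E0 mulr0.
  by apply/funext => w; rewrite mulN1r.
have K := Ex_le0_ae0 (itgN iE) key EN.
apply: filterS3 (filterI N0 M0) (filterI DE H1) (filterI YI K) => w [N0' M0'] [DE' H1'] [YI' K'] Aw.
apply: le_lt_trans H1' _.
apply/DE'; apply: contrapT => nD.
move: K'; rewrite /= /excess YI' !indicE (mem_set (_ : (~` D) w))// (mem_set Aw) mul1r.
have U0 : 0 <= U w by rewrite leNgt; apply/negP => /DE'.
rewrite mulr1 -/N opprB mulNr opprK => K'.
have : 0 < U w * N w + eps * M w.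
  by apply: ltr_wpDl; [exact: mulr_ge0 U0 (ltW N0')|exact: mulr_gt0].
by rewrite K' ltxx.
Qed.

(** * Time-consistency *)

Let cancel1 (x y z i : R) : x = i * y -> x = i * z -> i = 1 -> z = y.
Proof. by move=> xy xz i1; move: xz; rewrite xy i1 !mul1r. Qed.

(** [phi_t] is dominated by the average of [X] replaced by [phi_s(X)]: concatenate
    to [a] elements whose averages tend to [phi_s(X)]. *)
Lemma phi_le_average_replace t s a C X : (t <= s)%N -> tle (Some s) T -> F s C ->
  bproc X -> Q a ->
  {ae P, forall w, phi t X w <= ave t a (replace_from s C (phi s X) X) w}.
Proof.
move=> ts sT FC bX Qa; have tT := horizon_tle ts sT.
have [b_ Qb bphi] := phi_limit sT bX.
have [_ [m Xm]] := bX; have mC : measurable C by exact: FM FC.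
have Lphi := phi_Linfty sT bX.
have Lb n := average_Linfty (sF s) (FM (t:=s)) (wt (Qb n)) (ms (Qb n) sT) bX.
have phim : {ae P, forall w, `|phi s X w| <= m}.
  by apply: (phi_norm sT bX); apply: filterS Xm => w Xm r _.
have bm n : {ae P, forall w, `|ave s (b_ n) X w| <= m}.
  apply: (average_norm (sF s) (FM (t:=s)) (wt (Qb n)) (ms (Qb n) sT) bX).
  by apply: filterS Xm => w Xm r _.
apply: (@cvg_le_average _ _ _ P (F t) (sF t) (FM (t:=t)) (horizon T t) (increment a)
  (wt Qa) (ms Qa tT) (fun n => replace_from s C (ave s (b_ n) X) X)
  (replace_from s C (phi s X) X) (phi t X)
  (fun n w => `|ave s (b_ n) X w - phi s X w|) (m + m)).
- by move=> n; apply: bounded_replace_from => //; [exact: (Lb n).1.1|exact: (Lb n).2].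
- by apply: bounded_replace_from => //; [exact: Lphi.1.1|exact: Lphi.2].
- exact: (phi_Linfty tT bX).
- move=> n; apply: aeW => w r _; rewrite /replace_from; case: ifP => _ //.
  by rewrite subrr normr0.
- move=> n; apply: filterS2 (bm n) phim => w h1 h2.
  by apply: (le_trans (ler_normB _ _)); exact: lerD.
- apply: filterS bphi => w bw; rewrite -(normr0 R) -(subrr (phi s X w)).
  by apply: cvg_norm; apply: cvgB => //; exact: cvg_cst.
move=> n; have [c Qc cE] := stable_average Qa (Qb n) sT FC.
have H1 := phi_le tT bX Qc.
by apply: filterS2 H1 (cE t X ts bX) => w + <-.
Qed.

(** Conversely, by the tower property, replacing [X] by something below its own
    average lowers the average. *)
Lemma average_replace_le t s a C X U : (t <= s)%N -> tle (Some s) T -> F s C ->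
  bproc X -> Q a -> Linfty P (F s) U ->
  {ae P, forall w, C w -> U w <= ave s a X w} ->
  {ae P, forall w, ave t a (replace_from s C U X) w <= ave t a X w}.
Proof.
move=> ts sT FC bX Qa LU Ule; have tT := horizon_tle ts sT.
have mC : measurable C by exact: FM FC.
have La := average_Linfty (sF s) (FM (t:=s)) (wt Qa) (ms Qa sT) bX.
have bU : bproc (replace_from s C U X).
  by apply: bounded_replace_from => //; [exact: LU.1.1|exact: LU.2].
have ba : bproc (replace_from s C (ave s a X) X).
  by apply: bounded_replace_from => //; [exact: La.1.1|exact: La.2].
have H1 : {ae P, forall w, ave t a (replace_from s C U X) w <=
    ave t a (replace_from s C (ave s a X) X) w}.
  apply: (le_average (sF t) (FM (t:=t)) (wt Qa) (ms Qa tT) bU ba).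
  apply: filterS Ule => w Ule r _; rewrite /replace_from.
  case: ifPn => [/andP[_ /set_mem wC]|_]; [exact: Ule|exact: lexx].
have ms' : {ae P, forall w, 0 < mass (fun r => horizon T t r && (s <= r)%N) (increment a) w}.
  by rewrite (horizon_from ts); exact: ms.
have := @average_tower _ _ _ P (F t) (F s) (sF t) (FM (t:=t)) (sF s) (FM (t:=s))
  (FF ts) (horizon T t) s C (increment a) X (wt Qa) (ms Qa tT) ms' FC bX.
rewrite (horizon_from ts) => H2.
by apply: filterS2 H1 H2 => w + ->.
Qed.

Variables (t0 : nat) (theta : Omega -> natbar) (X : nat -> Omega -> R).
Hypotheses (t0T : tle (Some t0) T) (st : stopping_time F theta).
Hypotheses (fin : ae_finite P theta) (t0theta : ae_tle P (cst (Some t0)) theta).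
Hypotheses (thetaT : ae_tle P theta (cst T)) (bX : bproc X).

(* [at_ n] is the event that [theta] takes the value [n]. *)
Let at_ n : set Omega := [set w | theta w = Some n].

Let F_at n : F n (at_ n).
Proof.
have [F0 FC FU] := sF n.
have FS : F n (~` (at_ n)) -> F n (at_ n).
  by move=> H; rewrite -[at_ n]setCK -setTD; exact: FC.
apply: FS; case: n F0 FC FU => [|n] F0 FC FU.
  rewrite (_ : ~` _ = setT `\` [set w | tle (theta w) (Some 0%N)]); first exact/FC/st.
  rewrite setTD; congr (~` _); apply/seteqP; split => w; rewrite /at_ /=; first by move=> ->.
  by case: (theta w) => [k|]//=; rewrite leqn0 => /eqP ->.
have H1 : F n.+1 (~` [set w | tle (theta w) (Some n.+1)]) by rewrite -setTD; exact/FC/st.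
have H2 : F n.+1 [set w | tle (theta w) (Some n)] by exact: (FF (leqnSn n) (st n)).
rewrite (_ : ~` _ = \bigcup_k (if k is 0%N then ~` [set w | tle (theta w) (Some n.+1)]
    else [set w | tle (theta w) (Some n)])); first by apply: FU => -[].
apply/seteqP; split => w.
  rewrite /at_ /= => H; case E : (theta w) => [k|]; last by exists 0%N => //=; rewrite E.
  have [kn|nk] := leqP k n; first by exists 1%N => //=; rewrite E.
  exists 0%N => //=; rewrite E /=; apply/negP; rewrite -ltnNge ltn_neqAle nk andbT.
  by apply/eqP => kE; apply: H; rewrite E -kE.
move=> [[_|k _]] /=; rewrite /at_ /= => H E; rewrite E /= in H; first by apply: H.
by rewrite ltnn in H.
Qed.

Let m_at n : measurable (at_ n). Proof. exact: FM (F_at n). Qed.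

(** The process in which [X] is replaced by [phi_{theta,T}(X)] from [theta] on, on
    the event where [t0 <= theta <= T] and [theta < N]. *)
Definition cut N : nat -> Omega -> R := fun r w =>
  if theta w is Some n then
    if [&& (t0 <= n)%N, tle (Some n) T, (n < N)%N & (n <= r)%N]
    then phi n X w else X r w
  else X r w.

(** One more value of [theta] is one more replacement at a deterministic time. *)
Lemma cutS N : cut N.+1 = if (t0 <= N)%N && tle (Some N) T
  then replace_from N (at_ N) (phi N X) (cut N) else cut N.
Proof.
case: ifPn => [/andP[tN NT]|nN]; apply/funext => r; apply/funext => w.
  rewrite /cut /replace_from.
  case: (boolP (w \in at_ N)) => wN.
    have -> : theta w = Some N by exact: set_mem wN.
    by rewrite tN NT ltnSn ltnn /= andbT; case: ifP.
  rewrite andbF; case E : (theta w) => [n|//].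
  rewrite ltnS (leq_eqVlt n N); case: eqP => [nN|_ //].
  by move: wN; rewrite mem_set// /at_ /= E nN.
rewrite /cut; case E : (theta w) => [n|//].
rewrite ltnS (leq_eqVlt n N); case: eqP => [nN'|_ //].
rewrite nN' ltnn /= !andbF; case: ifPn => // /and3P[h1 h2 _].
by case/negP: nN; rewrite h1; exact: h2.
Qed.

Let m_X : exists m : R, {ae P, forall w, forall r, `|X r w| <= m} /\
  {ae P, forall w, forall n, tle (Some n) T -> `|phi n X w| <= m}.
Proof.
have [_ [m Xm]] := bX; exists m; split => //; apply/ae_foralln => n.
have [nT|nT] := boolP (tle (Some n) T); last by apply: aeW => w h; discriminate h.
have : {ae P, forall w, `|phi n X w| <= m}.
  by apply: (phi_norm nT bX); apply: filterS Xm => w Xm r _.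
by apply: filterS => w ? _.
Qed.

Lemma cut_norm (m : R) : {ae P, forall w, forall r, `|X r w| <= m} ->
  {ae P, forall w, forall n, tle (Some n) T -> `|phi n X w| <= m} ->
  {ae P, forall w, forall N r, `|cut N r w| <= m}.
Proof.
move=> Xm pm; apply: filterS2 Xm pm => w Xm pm N r; rewrite /cut.
case: (theta w) => [n|]; last exact: Xm.
case: ifPn => [/and4P[_ nT _ _]|_]; [exact: pm|exact: Xm].
Qed.

Lemma bounded_cut N : bproc (cut N).
Proof.
elim: N => [|N IH].
  rewrite (_ : cut 0 = X)//; apply/funext => r; apply/funext => w; rewrite /cut.
  by case: (theta w) => // n; rewrite !andbF.
rewrite cutS; case: ifPn => // /andP[_ NT].
have L := phi_Linfty NT bX.
by apply: bounded_replace_from => //; [exact: L.1.1|exact: L.2].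
Qed.

(** The limit of [cut N]; at time [r] only the values [theta <= r] matter. *)
Definition cut_limit : nat -> Omega -> R := fun r => cut r.+1 r.

Lemma bounded_cut_limit : bproc cut_limit.
Proof.
split; first by move=> r; exact: (bounded_cut r.+1).1.
have [m [Xm pm]] := m_X; exists m.
by apply: filterS (cut_norm Xm pm) => w H r; exact: H.
Qed.

(** On [{theta = N}] no replacement has taken place yet. *)
Lemma cut_atE N : {ae P, forall w, at_ N w -> (tle (Some N) T) ->
  phi N (cut N) w = phi N X w}.
Proof.
have [NT|NT] := boolP (tle (Some N) T); last by apply: aeW => w _ h; discriminate h.
have H1 := phi_local NT bX (F_at N).
have H2 := phi_local NT (bounded_cut N) (F_at N).
have E : (fun r w => \1_(at_ N) w * cut N r w) = (fun r w => \1_(at_ N) w * X r w).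
  apply/funext => r; apply/funext => w; rewrite indicE.
  case: (boolP (w \in at_ N)) => [/set_mem wN|]; last by rewrite !mul0r.
  congr (_ * _); rewrite /cut.
  have -> : theta w = Some N by exact: wN.
  by rewrite ltnn !andbF.
rewrite E in H2; apply: filterS2 H1 H2 => w h1 h2 wN _.
have i1 : \1_(at_ N) w = 1 :> R by rewrite indicE mem_set.
exact: (cancel1 h1 h2 i1).
Qed.

Lemma phi_le_cut N : {ae P, forall w, phi t0 X w <= phi t0 (cut N) w}.
Proof.
elim: N => [|N IH].
  rewrite (_ : cut 0 = X); first exact: aeW.
  apply/funext => r; apply/funext => w; rewrite /cut.
  by case: (theta w) => // n; rewrite !andbF.
have bN := bounded_cut N; have bN1 := bounded_cut N.+1.
case: ifPn (cutS N) bN1 => [/andP[tN NT] -> bN1|_ -> _]; last exact: IH.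
have H : {ae P, forall w, phi t0 (cut N) w <=
    phi t0 (replace_from N (at_ N) (phi N X) (cut N)) w}.
  apply: (phi_ge t0T bN1).
    exact: (phi_measurable t0T bN).
  move=> a Qa; have H1 := phi_le_average_replace tN NT (F_at N) bN Qa.
  have L' := phi_Linfty NT bN.
  have bN' : bproc (replace_from N (at_ N) (phi N (cut N)) (cut N)).
    by apply: bounded_replace_from => //; [exact: L'.1.1|exact: L'.2].
  have H2 : {ae P, forall w, ave t0 a (replace_from N (at_ N) (phi N (cut N)) (cut N)) w =
     ave t0 a (replace_from N (at_ N) (phi N X) (cut N)) w}.
    apply: (eq_average (sF t0) (FM (t:=t0)) (wt Qa) (ms Qa t0T) bN' bN1).
    apply: filterS (cut_atE N) => w E r _; rewrite /replace_from.
    case: (boolP ((N <= r)%N && (w \in at_ N))) => [/andP[_ /set_mem wN]|_].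
      exact: (E wN NT).
    reflexivity.
  by apply: filterS2 H1 H2 => w + <-.
by apply: filterS2 IH H => w; exact: le_trans.
Qed.

Lemma average_cut_le N a : Q a ->
  {ae P, forall w, ave t0 a (cut N) w <= ave t0 a X w}.
Proof.
move=> Qa; elim: N => [|N IH].
  rewrite (_ : cut 0 = X); first exact: aeW.
  apply/funext => r; apply/funext => w; rewrite /cut.
  by case: (theta w) => // n; rewrite !andbF.
case: ifPn (cutS N) => [/andP[tN NT] ->|_ ->]; last exact: IH.
have bN := bounded_cut N.
have H1 := phi_le NT bN Qa.
have H : {ae P, forall w, ave t0 a (replace_from N (at_ N) (phi N X) (cut N)) w <=
    ave t0 a (cut N) w}.
  apply: (average_replace_le tN NT (F_at N) bN Qa).
    exact: (phi_Linfty NT bX).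
  by apply: filterS2 H1 (cut_atE N) => w + E wN; rewrite (E wN NT).
by apply: filterS2 H IH => w; exact: le_trans.
Qed.

Lemma phi_cut_limit : {ae P, forall w, phi t0 X w = phi t0 cut_limit w}.
Proof.
have bL := bounded_cut_limit; have [m [Xm pm]] := m_X.
have cm := cut_norm Xm pm.
(* [cut N] differs from its limit only on the event [{theta >= N}]. *)
pose dl N w : R := if theta w is Some n then if (n < N)%N then 0 else m + m else 0.
have dle N : {ae P, forall w, forall r, horizon T t0 r ->
    `|cut N r w - cut_limit r w| <= dl N w}.
  apply: filterS cm => w cm r _.
  have d1 : `|cut N r w - cut_limit r w| <= m + m.
    apply: (le_trans (ler_normB _ _)); apply: lerD; first exact: cm.
    by rewrite /cut_limit; exact: cm.
  rewrite /dl; case E : (theta w) => [n|].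
    case: ifPn => // nN; rewrite /cut_limit /cut E nN ltnS andbb.
    by rewrite subrr normr0.
  by rewrite /cut_limit /cut E subrr normr0.
have dm N : {ae P, forall w, dl N w <= m + m}.
  apply: filterS Xm => w Xm; have m0 : 0 <= m + m.
    by apply: addr_ge0; rewrite (le_trans _ (Xm 0%N)).
  by rewrite /dl; case: (theta w) => // n; case: ifP.
have d0 : {ae P, forall w, dl ^~ w @ \oo --> (0 : R)}.
  apply: aeW => w; apply: cvg_near_cst; rewrite /dl; case: (theta w) => [n|].
    by exists n.+1 => // N /= nN; rewrite nN.
  exact: nearW.
apply: ae_le_anti.
  apply: (phi_ge t0T bL).
    exact: (phi_measurable t0T bX).
  move=> a Qa; apply: (cvg_le_average (sF t0) (FM (t:=t0)) (wt Qa) (ms Qa t0T)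
    (fun N => bounded_cut N) bL (phi_Linfty t0T bX) dle dm d0) => N.
  have H1 := phi_le t0T (bounded_cut N) Qa.
  by apply: filterS2 (phi_le_cut N) H1 => w; exact: le_trans.
apply: (phi_ge t0T bX).
  exact: (phi_measurable t0T bL).
move=> a Qa; have H1 := phi_le t0T bL Qa.
have H2 := cvg_average_le (sF t0) (FM (t:=t0)) (wt Qa) (ms Qa t0T)
    (fun N => bounded_cut N) bL
    (average_Linfty (sF t0) (FM (t:=t0)) (wt Qa) (ms Qa t0T) bX) dle dm d0
    (fun N => average_cut_le N Qa).
by apply: filterS2 H1 H2 => w; exact: le_trans.
Qed.

(* The process at which [phi s] is evaluated in the definition of
   [phi_{theta,T}(X)]. *)
Let stopped s : nat -> Omega -> R := fun r w =>
  \1_[set w' | theta w' = Some s] w * stop_proj theta (cst T) X r w.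

Let measurable_le_theta r : measurable [set w | tle (theta w) (Some r)].
Proof. exact: FM (st r). Qed.

Let bounded_stopped s : bproc (stopped s).
Proof.
split => [r|].
  rewrite /stopped; apply: measurable_funM; first by apply: measurable_indic; exact: m_at.
  rewrite /stop_proj; apply: measurable_fun_ifT; last exact: measurable_cst.
    by apply: (measurable_fun_bool true); rewrite setTI; exact: measurable_le_theta.
  exact: bX.1.
have [_ [m Xm]] := bX; exists m; apply: filterS Xm => w Xm r.
have m0 : 0 <= m by rewrite (le_trans _ (Xm 0%N)).
rewrite /stopped /stop_proj indicE; case: (w \in _); last by rewrite mul0r normr0.
by rewrite mul1r; case: ifP => _; [exact: Xm|rewrite normr0].
Qed.

Let phi_stopped s : tle (Some s) T ->
  {ae P, forall w, phi s (stopped s) w = \1_(at_ s) w * phi s X w}.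
Proof.
move=> sT; have H1 := phi_local sT bX (F_at s).
have bY : bproc (fun r w => \1_(at_ s) w * X r w).
  split => [r|]; first by apply: measurable_funM; [apply: measurable_indic; exact: m_at|exact: bX.1].
  have [_ [m Xm]] := bX; exists m; apply: filterS Xm => w Xm r.
  rewrite normrM (le_trans _ (Xm r))// ler_piMl// indicE.
  by case: (w \in _); rewrite ?normr1 ?normr0.
have H2 : {ae P, forall w, phi s (stopped s) w = phi s (fun r w => \1_(at_ s) w * X r w) w}.
  apply: (phi_eq sT (bounded_stopped s) bY).
  apply: aeW => w r /andP[sr rT]; rewrite /stopped -/(at_ s) indicE.
  case: (boolP (w \in at_ s)) => [/set_mem ws|]; last by rewrite !mul0r.
  have ws' : theta w = Some s by exact: ws.
  rewrite !mul1r /stop_proj ws' /= sr; congr (X _ w).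
  by case: (T) rT => [n|]//= /minn_idPl.
by apply: filterS2 H1 H2 => w <-.
Qed.

Lemma phi_stopE : {ae P, forall w, forall n, theta w = Some n -> tle (Some n) T ->
  phi_stop T (phi_of P F Q T) theta X w = phi n X w}.
Proof.
have H : {ae P, forall w, forall s, tle (Some s) T ->
    phi s (stopped s) w = \1_(at_ s) w * phi s X w}.
  apply/ae_foralln => s; have [sT|sT] := boolP (tle (Some s) T); last by apply: aeW => w h; discriminate h.
  by apply: filterS (phi_stopped sT) => w ? _.
apply: filterS H => w H n wn nT; rewrite /phi_stop.
apply/cvg_lim => //; apply: cvg_near_cst; exists n.+1 => // N nN.
rewrite /= in nN.
rewrite big_mkcond (big_cat_nat (n := n.+1)) // big_nat_recr // nT.
rewrite big_nat big1 ?Monoid.mul1m => [|s /andP[_ sn]]; last first.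
  case: ifP => // sT; rewrite [LHS](H s sT) indicE memNset ?mul0r//.
  by rewrite /at_ /= wn => -[ns]; rewrite ns ltnn in sn.
rewrite big_nat big1 ?Monoid.mulm1 => [|s /andP[ns _]]; last first.
  case: ifP => // sT; rewrite [LHS](H s sT) indicE memNset ?mul0r//.
  by rewrite /at_ /= wn => -[ns']; rewrite ns' ltnn in ns.
by rewrite [LHS](H n nT) indicE mem_set ?mul1r.
Qed.

(* The process [X 1_{[t0,theta)} + phi_{theta,T}(X) 1_{[theta,oo)}]. *)
Let pasted : nat -> Omega -> R := fun s w =>
  X s w * ind_between (cst (Some t0)) theta s w
  + phi_stop T (phi_of P F Q T) theta X w * ind_from theta s w.

Let pastedE : {ae P, forall w, forall r,
  pasted r w = if (t0 <= r)%N then cut_limit r w else 0}.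
Proof.
apply: filterS3 (filterI fin t0theta) thetaT phi_stopE => w [fw tw] wT H r.
rewrite /pasted /ind_between /ind_from /cut_limit /cut /=.
case E : (theta w) fw tw wT H => [n|]//= _ tn nT H.
rewrite tn nT ltnS andbb (H n erefl nT) /=.
have [nr|rn] := leqP n r.
  by rewrite (leq_trans tn nr) /= mulr0 mulr1 add0r.
by rewrite andbT mulr0 addr0; case: ifP => _; rewrite ?mulr1 ?mulr0.
Qed.

Let bounded_pasted : bproc pasted.
Proof.
split => [r|]; last first.
  have [_ [m Lm]] := bounded_cut_limit; exists m.
  apply: filterS2 Lm pastedE => w Lm E r; rewrite E; case: ifP => _; first exact: Lm.
  by rewrite normr0 (le_trans _ (Lm 0%N)).
have mth : measurable_fun setT (fun w => tle (theta w) (Some r)).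
  by apply: (measurable_fun_bool true); rewrite setTI; exact: measurable_le_theta.
have m1 : measurable_fun setT (fun _ : Omega => 1 : R) by exact: measurable_cst.
have m0 : measurable_fun setT (fun _ : Omega => 0 : R) by exact: measurable_cst.
apply: measurable_funD; apply: measurable_funM.
- exact: bX.1.
- rewrite /ind_between; apply: (measurable_fun_ifT _ m1 m0); apply: measurable_and.
    exact: measurable_cst.
  exact: measurable_neg.
- apply: (@measurable_fun_lim _ _ _ (fun N w => \sum_(0 <= s < N | tle (Some s) T)
      phi s (stopped s) w)) => N.
  under eq_fun do rewrite big_mkcond.
  apply: measurable_sum => s; have [sT|sT] := boolP (tle (Some s) T); last exact: m0.
  exact: (phi_measurable sT (bounded_stopped s)).
- by rewrite /ind_from; exact: (measurable_fun_ifT mth m1 m0).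
Qed.

Lemma phi_pasted : {ae P, forall w, phi t0 X w = phi t0 (fun s w' =>
  X s w' * ind_between (cst (Some t0)) theta s w'
  + phi_stop T (phi_of P F Q T) theta X w' * ind_from theta s w') w}.
Proof.
have H : {ae P, forall w, phi t0 pasted w = phi t0 cut_limit w}.
  apply: (phi_eq t0T bounded_pasted bounded_cut_limit).
  by apply: filterS pastedE => w E r /andP[tr _]; rewrite E tr.
by apply: filterS2 phi_cut_limit H => w -> <-.
Qed.

End utility_process.

Theorem theorem4p16 (R : realType) (d : measure_display)
    (Omega : measurableType d) (P : probability Omega R)
    (F : nat -> set (set Omega))
    (hF : filtration F) (hF0 : F 0%N = [set set0; setT])
    (T : natbar) (Qe : set (nat -> Omega -> R))
    (hQ0 : Qe !=set0)
    (hQD : Qe `<=` Dset_e P F (cst (Some 0%N)) (cst T))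
    (hQstable : stable_under_concatenation P F Qe) :
  [/\ coherent_utility_process P F T (phi_of P F Qe T),
      relevant_process P F T (phi_of P F Qe T)
    & time_consistent P F T (phi_of P F Qe T)].
Proof.
have adm a : Qe a -> admissible P T a by move/hQD; exact: Dset_e_admissible.
split; [exact: coherent_phi|exact: relevant_phi|].
move=> t theta X tT st fin tth thT /Rinfty_between_bounded bX.
exact: phi_pasted.
Qed.
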